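(* Let $(T(t))_{t\ge 0}$ be the semigroup on $L^1(S)$ associated with the operator $\mathcal{A}$ (see context). Let $u\in L^1(S)$. Then $\overline{(T(t)u)}_S=\overline{(u)}_S$ for every $t\ge 0$.
   Context: Setting. Let $n\in\mathbb{N}$, $n\ge 2$; let $\emptyset\ne S\subseteq\mathbb{R}^n$ be open, connected, bounded and of class $C^1$; let $p\in(1,\infty)\setminus\{2\}$. Let $\lambda$ be Lebesgue measure and $|\cdot|$ the Euclidean norm. Let $\gamma:S\to(0,\infty)$ satisfy $\gamma\in L^\infty(S)$, $\gamma^{1/(1-p)}\in L^1(S)$, and assume there is a Muckenhoupt weight $\gamma_0\in A_p(\mathbb{R}^n)$ with $\gamma_0|_S=\gamma$ a.e. on $S$. Here $A_p(\mathbb{R}^n)$ is the set of $\gamma_0:\mathbb{R}^n\to\mathbb{R}$ with $\gamma_0>0$ a.e., $\gamma_0\in L^1_{\mathrm{loc}}(\mathbb{R}^n)$ and $\sup_B \frac{1}{\lambda(B)}\int_B\gamma_0\,d\lambda\left(\frac{1}{\lambda(B)}\int_B\gamma_0^{1/(1-p)}d\lambda\right)^{p-1}<\infty$, the supremum over all balls $B\subseteq\mathbb{R}^n$. Let $\nu(B):=\int_B\gamma\,d\lambda$ and $W^{1,p}_\gamma(S):=\{f\in L^p(S): f \text{ weakly differentiable},\ \nabla f\in L^p(S,\nu;\mathbb{R}^n)\}$. Truncation and generalized gradient. For $k>0$, $\tau_k(s):=s$ if $|s|<k$ and $\tau_k(s):=k\,\mathrm{sign}(s)$ if $|s|\ge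 k$. If $f:S\to\mathbb{R}$ is measurable with $\tau_k(f)\in W^{1,1}_{\mathrm{loc}}(S)$ for all $k>0$, then $\tilde\nabla f:S\to\mathbb{R}^n$ is the a.e. unique function with $\nabla\tau_k(f)=\tilde\nabla f\,\mathbf{1}_{\{|f|<k\}}$ a.e. for all $k>0$. Operators (identified with their graphs). $A\subseteq L^1(S)\times L^1(S)$: $(f,\hat f)\in A$ iff $f\in W^{1,p}_\gamma(S)\cap L^\infty(S)$, $\hat f\in L^1(S)$ and $\int_S\gamma|\nabla f|^{p-2}\nabla f\cdot\nabla\varphi\,d\lambda=\int_S\hat f\varphi\,d\lambda$ for all $\varphi\in W^{1,p}_\gamma(S)\cap L^\infty(S)$. $\mathcal{A}\subseteq L^1(S)\times L^1(S)$: $(f,\hat f)\in\mathcal{A}$ iff $f,\hat f\in L^1(S)$, $\tau_k(f)\in W^{1,p}_\gamma(S)$ for all $k>0$, and $\int_S\gamma|\tilde\nabla f|^{p-2}\tilde\nabla f\cdot\nabla(\tau_k(f-\varphi))\,d\lambda\le\int_S\hat f\,\tau_k(f-\varphi)\,d\lambda$ for all $k>0$ and $\varphi\in W^{1,p}_\gamma(S)\cap L^\infty(S)$. Semigroup. It is known (prior work) that $\mathcal{A}$ is completely accretive, m-accretive in $L^1(S)$ and the closure of $A$, that $D(A)$ is dense in $L^1(S)$, and that for each $u\in L^1(S)$ there is a unique strong solution (which is also the unique mild solution) $T(\cdot)u\in C([0,\infty);L^1(S))\cap W^{1,1}_{\mathrm{loc}}((0,\infty);L^1(S))$ of $0\in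 T'(t)u+\mathcal{A}T(t)u$, $T(t)u\in D(\mathcal{A})$ for a.e. $t>0$, $T(0)u=u$. Here $W^{1,1}_{\mathrm{loc}}((0,\infty);X)$ denotes the locally absolutely continuous, a.e. differentiable functions $(0,\infty)\to X$, and $T'(t)u$ is the a.e. derivative of $T(\cdot)u$. $(T(t))_{t\ge0}$ is this semigroup. (Complete accretivity of $\mathcal{A}$ means: for all $(f,\hat f),(h,\hat h)\in\mathcal{A}$, $\alpha>0$ and all convex lower semicontinuous $j:\mathbb{R}\to[0,\infty]$ with $j(0)=0$, $\int_S j(f-h)d\lambda\le\int_S j(f-h+\alpha(\hat f-\hat h))d\lambda$.) Average. $\overline{(u)}_S:=\frac{1}{\lambda(S)}\int_S u\,d\lambda$ for $u\in L^1(S)$. *)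

(* Defs.v *)
From HB Require Import structures.
From mathcomp Require Import all_boot all_order all_algebra.
From mathcomp Require Import all_classical all_reals all_analysis.
From mathcomp Require Import measurable_realfun.

Set Implicit Arguments.
Unset Strict Implicit.
Unset Printing Implicit Defensive.
Import Order.TTheory GRing.Theory Num.Theory.
Import numFieldNormedType.Exports.

Local Open Scope classical_set_scope.
Local Open Scope ring_scope.

(* MathComp-Analysis has no measurable structure on R^n = 'rV[R]_n compatible
   with its topology, nor an n-dimensional Lebesgue measure; both are built
   here. Every function space below is described by Borel representatives
   'rV[R]_n -> R, of which only the values on the domain matter. *)
Section borel_rV.
Context {R : realType} {n : nat}.

Definition borel_rV : set (set 'rV[R]_n) := <<s @open 'rV[R]_n >>.

Let borel_rV0 : borel_rV set0. Proof. exact: sigma_algebra0. Qed.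

Let borel_rVC A : borel_rV A -> borel_rV (~` A).
Proof. exact: sigma_algebraC. Qed.

Let borel_rV_bigcup (F : (set 'rV[R]_n)^nat) :
  (forall i, borel_rV (F i)) -> borel_rV (\bigcup_i F i).
Proof. exact: sigma_algebra_bigcup. Qed.

HB.instance Definition _ := @isMeasurable.Build
  (sigma_display (@open 'rV[R]_n)) 'rV[R]_n borel_rV
  borel_rV0 borel_rVC borel_rV_bigcup.

End borel_rV.

Section cons_rV.
Context {R : realType} {n : nat}.

Definition cons_rV (z : measurableTypeR R * 'rV[R]_n) : 'rV[R]_n.+1 :=
  row_mx (z.1 : R)%:M z.2.

Definition uncons_rV (v : 'rV[R]_n.+1) : measurableTypeR R * 'rV[R]_n :=
  (v 0 0, @rsubmx R 1 1 n v).

Lemma uncons_rVK : cancel uncons_rV cons_rV.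
Proof.
move=> v; rewrite /cons_rV /= -[RHS](@hsubmxK R 1 1 n v).
suff -> : (v 0 0)%:M = @lsubmx R 1 1 n v by [].
apply/matrixP => i j; rewrite !ord1 !mxE/= mulr1n; congr (v _ _).
exact/val_inj.
Qed.

Lemma cons_rVK : cancel cons_rV uncons_rV.
Proof.
move=> -[x v]; rewrite /uncons_rV /cons_rV/= row_mxKr; congr pair.
by rewrite mxE; case: splitP => // j _; rewrite mxE !ord1 eqxx.
Qed.

Lemma cons_rV0 z : cons_rV z 0 0 = z.1.
Proof. by rewrite -{2}(cons_rVK z). Qed.

Lemma cons_rVS z i : cons_rV z 0 (lift ord0 i) = z.2 0 i.
Proof.
rewrite -{2}(cons_rVK z) [RHS]mxE.
have e : @lift n.+1 ord0 i = @rshift 1 n i by exact/val_inj.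
exact: (congr1 (cons_rV z 0) e).
Qed.

End cons_rV.

Section measurable_rV.
Context {R : realType}.

Lemma open_rV_boxes n (U : set 'rV[R]_n) : open U -> exists B : set ('rV[rat]_n * nat),
  U = \bigcup_(qk in B)
    [set v | forall i, ball (ratr (qk.1 0 i) : R) qk.2.+1%:R^-1 (v 0 i)].
Proof.
move=> oU; pose box (qk : 'rV[rat]_n * nat) : set 'rV[R]_n :=
  [set v | forall i, ball (ratr (qk.1 0 i) : R) qk.2.+1%:R^-1 (v 0 i)].
exists [set qk | box qk `<=` U]; apply/seteqP; split=> [v Uv|v [qk /= sU] bv].
  2: exact: sU.
have /nbhs_ballP[e /= e0 eU] : nbhs v U by exact: open_nbhs_nbhs.
have [k ke] : exists k, k.+1%:R^-1 < e / 2 :> R.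
  have e20 : 0 < e / 2 by rewrite divr_gt0.
  have [N _ /(_ N (leqnn N)) hN] := near_infty_natSinv_lt (PosNum e20).
  by exists N.
have k0 : 0 < k.+1%:R^-1 :> R by rewrite invr_gt0.
have /choice[q hq] (i : 'I_n) : exists q : rat, ball (v 0 i) k.+1%:R^-1 (ratr q : R).
  have : ball (v 0 i) k.+1%:R^-1 `&` range (@ratr R) !=set0.
    by apply: dense_rat; [exists (v 0 i); exact: ballxx|exact: ball_open].
  by move=> [_ [] /[swap] -[q _ <-] vq]; exists q.
exists (\row_i q i, k) => /=; last first.
  by move=> i /=; rewrite mxE; exact: ball_sym.
move=> w /= bw; apply: eU; split => // i j; rewrite ord1 (splitr e).
apply: (@ball_triangle _ _ (ratr (q j) : R)).
  by apply: le_ball (hq j); exact: ltW.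
by have := bw j; rewrite mxE => /=; apply: le_ball; exact: ltW.
Qed.

Lemma measurable_fun_rV d (T : measurableType d) n (f : T -> 'rV[R]_n) :
  (forall i, measurable_fun setT (fun t => f t 0 i)) -> measurable_fun setT f.
Proof.
move=> mf; apply: (@measurability _ _ _ _ setT f (@open 'rV[R]_n)) => //.
move=> _ [U /open_rV_boxes[B ->] <-].
rewrite setTI preimage_bigcup bigcup_mkcond.
apply: countable_bigcupT_measurable => // qk; case: ifPn => // _.
rewrite (_ : _ @^-1` _ = \bigcap_(i in setT)
  ((fun t => f t 0 i) @^-1` ball (ratr (qk.1 0 i) : R) qk.2.+1%:R^-1)).
  by apply: fin_bigcap_measurable => // i _; rewrite -[X in measurable X]setTI;
     apply: mf => //; apply: open_measurable; exact: ball_open.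
by apply/seteqP; split=> t /= h i => [_|]; apply: h.
Qed.

Lemma measurable_coord n (i : 'I_n) :
  measurable_fun setT (fun v : 'rV[R]_n => v 0 i).
Proof.
apply: (measurability _ (RGenOpens.measurableE R)).
move=> _ [_ [a [b ->] <-]]; rewrite setTI; apply: sub_sigma_algebra.
by apply: open_comp; [move=> v _; exact: coord_continuous|exact: interval_open].
Qed.

Lemma measurable_cons_rV n : measurable_fun setT (@cons_rV R n).
Proof.
apply: measurable_fun_rV => i.
have -> : (fun t => @cons_rV R n t 0 i) =
    match fintype.split (i : 'I_(1 + n)) with inl _ => fst | inr j => fun t => t.2 0 j end.
  apply/funext => t; rewrite /cons_rV !mxE; case: fintype.split => // j.
  by rewrite mxE !ord1 eqxx.
case: fintype.split => [_|j]; first exact: measurable_fst.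
exact: (measurableT_comp (measurable_coord j) measurable_snd).
Qed.

Lemma measurable_uncons_rV n : measurable_fun setT (@uncons_rV R n).
Proof.
apply/measurable_fun_pairP; split; first exact: measurable_coord.
apply: measurable_fun_rV => i; rewrite (_ : (fun t => _) =
    fun t : 'rV[R]_n.+1 => t 0 (rshift 1 i)); first exact: measurable_coord.
by apply/funext => t; rewrite /= mxE.
Qed.
End measurable_rV.


Section lebesgue_rV_step.
Context {R : realType} {n : nat} (mu : {sigma_finite_measure set 'rV[R]_n -> \bar R}).

Definition lebesgue_rV_step : set 'rV[R]_n.+1 -> \bar R :=
  pushforward (@lebesgue_measure R \x mu)%E cons_rV.


Let m : {measure set 'rV[R]_n.+1 -> \bar R} :=
  measure_function_pushforward__canonical__measure_function_Measure
    (@lebesgue_measure R \x mu)%E (@measurable_cons_rV R n).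

Let m0 : lebesgue_rV_step set0 = 0%E. Proof. exact: (measure0 m). Qed.

Let m_ge0 A : (0 <= lebesgue_rV_step A)%E. Proof. exact: (measure_ge0 m). Qed.

Let m_sigma_additive : semi_sigma_additive lebesgue_rV_step.
Proof. exact: (@measure_semi_sigma_additive _ _ _ m). Qed.

HB.instance Definition _ := isMeasure.Build _ _ _ lebesgue_rV_step
  m0 m_ge0 m_sigma_additive.

Let m_sigma_finite : sigma_finite setT lebesgue_rV_step.
Proof.
have /sigma_finiteP[F [FT ndF Foo]] := sigma_finiteT (@lebesgue_measure R).
have /sigma_finiteP[G [GT ndG Goo]] := sigma_finiteT mu.
exists (fun k => @uncons_rV R n @^-1` (F k `*` G k)).
  rewrite -preimage_bigcup -(preimage_setT (@uncons_rV R n)); congr (_ @^-1` _).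
  rewrite -setXTT FT GT; apply/seteqP; split => [[x y]|[x y] [k _ []]].
    move=> [[i _ /= Fx] [j _ /= Gy]]; exists (maxn i j) => //; split => /=.
      by move: x Fx; exact/subsetPset/ndF/leq_maxl.
    by move: y Gy; exact/subsetPset/ndG/leq_maxr.
  by split; exists k.
move=> k; have [mF ?] := Foo k; have [mG ?] := Goo k; split.
  rewrite -[X in measurable X]setTI; apply: measurable_uncons_rV => //.
  exact: measurableX.
rewrite /lebesgue_rV_step /pushforward -comp_preimage.
rewrite (_ : _ \o _ = id) ?preimage_id; last first.
  by apply/funext => x; exact: cons_rVK.
by rewrite product_measure1E// lte_mul_pinfty// ge0_fin_numE.
Qed.

HB.instance Definition _ := Measure_isSigmaFinite.Build _ _ _ lebesgue_rV_step
  m_sigma_finite.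
End lebesgue_rV_step.

(* n-fold product of the Lebesgue measure on R, transported along
   R * R^n ~ R^(n+1). *)
Fixpoint lebesgue_rV (R : realType) (n : nat) :
    {sigma_finite_measure set 'rV[R]_n -> \bar R} :=
  if n is m.+1 then lebesgue_rV_step (lebesgue_rV R m) else \d_(0 : 'rV[R]_0).

(* The defining value of the Lebesgue measure: the volume of a box. *)
Lemma lebesgue_rV_box (R : realType) n (a b : 'rV[R]_n) :
  (forall i, a 0 i <= b 0 i) ->
  lebesgue_rV R n [set v | forall i, a 0 i <= v 0 i <= b 0 i] =
  (\prod_i (b 0 i - a 0 i))%:E.
Proof.
elim: n a b => [|n IH] a b ab.
  by rewrite /= big_ord0 diracE mem_set// => -[].
pose a' : 'rV[R]_n := \row_i a 0 (lift ord0 i).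
pose b' : 'rV[R]_n := \row_i b 0 (lift ord0 i).
have boxE : @cons_rV R n @^-1` [set v : 'rV[R]_n.+1 | forall i, a 0 i <= v 0 i <= b 0 i] =
    (`[a 0 0, b 0 0]%classic : set (measurableTypeR R)) `*`
    [set v : 'rV[R]_n | forall i, a' 0 i <= v 0 i <= b' 0 i].
  apply/seteqP; split => [[x v] /= h|[x v] /= [h h'] i].
    split=> [|i]; first by have := h 0; rewrite in_itv cons_rV0.
    by have := h (lift ord0 i); rewrite cons_rVS !mxE.
  have [j ->|->] := unliftP ord0 i.
    by have := h' j; rewrite cons_rVS !mxE.
  by move: h; rewrite in_itv cons_rV0.
have mbox : measurable [set v : 'rV[R]_n | forall i, a' 0 i <= v 0 i <= b' 0 i].
  rewrite (_ : [set _ | _] = \bigcap_(i in setT)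
      ((fun v : 'rV[R]_n => v 0 i) @^-1` `[a' 0 i, b' 0 i]%classic)).
    apply: fin_bigcap_measurable => // i _; rewrite -[X in measurable X]setTI.
    by apply: measurable_coord => //; exact: measurable_itv.
  apply/seteqP; split => [v /= h i _|v h i]; first by rewrite /= in_itv; exact: h.
  by have := h i Logic.I; rewrite /= in_itv.
rewrite [LHS](congr1 _ boxE) product_measure1E//= IH; last by move=> i; rewrite !mxE.
rewrite lebesgue_measure_itv/= lte_fin big_ord_recl.
have -> : \prod_i (b' 0 i - a' 0 i) =
    \prod_(i < n) (b 0 (lift ord0 i) - a 0 (lift ord0 i)).
  by apply: eq_bigr => i _; rewrite !mxE.
case: ltP => [_|ba]; first by rewrite -EFinB -EFinM.
have -> : b 0 0 = a 0 0 by apply/eqP; rewrite eq_le ba ab.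
by rewrite mul0e subrr mul0r.
Qed.

Section euclidean.
Context {R : realType} {n : nat}.
Implicit Types u v x : 'rV[R]_n.

(* The library norm of 'rV[R]_n is the maximum norm. *)
Definition dot u v : R := \sum_i u 0 i * v 0 i.
Definition enorm v : R := Num.sqrt (dot v v).
Definition eball x (r : R) : set 'rV[R]_n := [set y | enorm (y - x) < r].

Definition partial (i : 'I_n) (f : 'rV[R]_n -> R) : 'rV[R]_n -> R :=
  'D_(delta_mx 0 i) f.

Definition is_C1 (f : 'rV[R]_n -> R) := forall i,
  (forall x, derivable f x (delta_mx 0 i)) /\ continuous (partial i f).

Definition is_smooth (f : 'rV[R]_n -> R) := forall s : seq 'I_n,
  let g := foldr partial f s in
  continuous g /\ forall i x, derivable g x (delta_mx 0 i).

End euclidean.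

(* Near each boundary point, S is one side of the graph of a C^1 function of
   n - 1 of the coordinates ([col' i y] is y without its i-th coordinate, and
   the sign (-1) ^+ b selects the side). *)
Definition C1_boundary {R : realType} {n : nat} (S : set 'rV[R]_n) :=
  forall x, (closure S `\` S°) x ->
  exists (r : R) (i : 'I_n) (b : bool) (g : 'rV[R]_n.-1 -> R),
    [/\ 0 < r, is_C1 g & forall y, eball x r y ->
        (S y <-> 0 < (-1) ^+ b * (y 0 i - g (col' i y)))].

Section function_spaces.
Context {R : realType} {n : nat}.
Local Notation leb := (lebesgue_rV R n).
Implicit Types (S : set 'rV[R]_n) (f g : 'rV[R]_n -> R).
Implicit Types F G : 'rV[R]_n -> 'rV[R]_n.

Definition L1 S f := leb.-integrable S (EFin \o f).

Definition L1_norm S f : R := \int[leb]_(x in S) `|f x|.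

Definition Lp (p : R) S f :=
  measurable_fun S f /\ (\int[leb]_(x in S) (`|f x| `^ p)%:E < +oo)%E.

Definition Linfty S f := measurable_fun S f /\
  exists M : R, {ae leb, forall x, S x -> `|f x| <= M}.

Definition L1_loc S f := measurable_fun S f /\
  forall K, compact K -> K `<=` S -> leb.-integrable K (EFin \o f).

Definition mean S f : R := (fine (leb S))^-1 * \int[leb]_(x in S) f x.

Definition test_function S f := is_smooth f /\
  let supp := closure [set x | f x != 0] in compact supp /\ supp `<=` S.

Definition weak_gradient S f G :=
  [/\ L1_loc S f,
      forall i, L1_loc S (fun x => G x 0 i) &
      forall eta, test_function S eta -> forall i,
        \int[leb]_(x in S) (f x * partial i eta x) =
        - \int[leb]_(x in S) (G x 0 i * eta x)].

Definition trunc (k s : R) : R := if `|s| < k then s else k * Num.sg s.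

Definition generalized_gradient S f F := measurable_fun S F /\
  forall k, 0 < k -> exists2 G, weak_gradient S (trunc k \o f) G &
    {ae leb, forall x, S x -> G x = if `|f x| < k then F x else 0}.

Definition average B f : \bar R :=
  ((fine (leb B))^-1%:E * \int[leb]_(x in B) (f x)%:E)%E.

Definition muckenhoupt (p : R) (w : 'rV[R]_n -> R) :=
  [/\ {ae leb, forall x, 0 < w x},
      L1_loc setT w &
      (ereal_sup [set average (eball z.1 z.2) w *
                      average (eball z.1 z.2) (fun x => w x `^ (1 - p)^-1)%R `^ (p - 1)%R
                | z in [set z : 'rV[R]_n * R | (0 < z.2)%R]] < +oo)%E].

(* W^{1,p}_gamma(S); integration against the measure nu = gamma d(lambda) is
   written as integration of the gamma-weighted integrand. *)
Definition weighted_sobolev (gamma : 'rV[R]_n -> R) (p : R) S f :=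
  Lp p S f /\ exists2 G, weak_gradient S f G &
    (\int[leb]_(x in S) (gamma x * enorm (G x) `^ p)%:E < +oo)%E.

(* |v|^(p-2) v; powR sends 0 to 0 for a nonzero exponent, so that for p <> 2
   this is 0 at v = 0, including for p < 2. *)
Definition p_flux (p : R) (v : 'rV[R]_n) : 'rV[R]_n := enorm v `^ (p - 2) *: v.

(* The graph of the operator written with a calligraphic A. The generalized
   gradient of f and the weak gradient of trunc k (f - phi) are unique up to
   null sets, so asking for some F and G asks for all of them. *)
Definition entropy_operator (gamma : 'rV[R]_n -> R) (p : R) S f fhat :=
  [/\ L1 S f, L1 S fhat,
      forall k, 0 < k -> weighted_sobolev gamma p S (trunc k \o f) &
      exists2 F, generalized_gradient S f F &
        forall (k : R) phi, 0 < k ->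
          weighted_sobolev gamma p S phi -> Linfty S phi ->
          exists2 G, weak_gradient S (fun x => trunc k (f x - phi x)) G &
            \int[leb]_(x in S) (gamma x * dot (p_flux p (F x)) (G x)) <=
            \int[leb]_(x in S) (fhat x * trunc k (f x - phi x))].

End function_spaces.

(* Curves t |-> v t with values in L^1(S), defined for t >= 0. *)
Section evolution.
Context {R : realType} {n : nat} (S : set 'rV[R]_n).
Local Notation leb := (lebesgue_rV R n).
Implicit Types (v : R -> 'rV[R]_n -> R) (B : ('rV[R]_n -> R) -> ('rV[R]_n -> R) -> Prop).

Definition L1_continuous v := forall t, 0 <= t ->
  (fun s => L1_norm S (v s \- v t)) @ within [set s | 0 <= s] (nbhs t) --> (0 : R).

Definition L1_locally_abs_continuous v := forall a b, 0 < a -> a < b ->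
  forall e, 0 < e -> exists2 d, 0 < d &
    forall (N : nat) (s t : 'I_N -> R),
      (forall i, [/\ a <= s i, s i <= t i & t i <= b]) ->
      trivIset setT (fun i => `]s i, t i[%classic) ->
      \sum_i (t i - s i) < d ->
      \sum_i L1_norm S (v (t i) \- v (s i)) < e.

Definition L1_derivative v (t : R) (d : 'rV[R]_n -> R) := L1 S d /\
  (fun h => L1_norm S (fun x => h^-1 * (v (t + h) x - v t x) - d x)) @ 0^' --> (0 : R).

(* Strong solution of 0 \in v' + B v, v 0 = u: the a.e. differentiability of v
   is part of the last clause. *)
Definition strong_solution B u v :=
  [/\ forall t, 0 <= t -> L1 S (v t),
      L1_continuous v /\ L1_locally_abs_continuous v,
      {ae leb, forall x, S x -> v 0 x = u x} &
      {ae @lebesgue_measure R, forall t, 0 < t ->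
        exists2 d, L1_derivative v t d & B (v t) (\- d)}].

Definition is_semigroup_of B (T : R -> ('rV[R]_n -> R) -> ('rV[R]_n -> R)) :=
  forall u, L1 S u -> strong_solution B u (fun t => T t u).

End evolution.

(* Main.v *)
(* For (f, fhat) in the operator, test with the constants phi = c and k = 1:
   the flux term is nonnegative, so 0 <= int fhat * trunc 1 (f - c), and letting
   c -> -oo and c -> +oo gives int fhat = 0 by dominated convergence.  Hence
   t |-> int T(t)u, which is locally absolutely continuous, has derivative 0
   almost everywhere, and it is continuous at 0.

   The sign of the flux term needs no chain rule for truncations: it suffices
   that two weakly differentiable functions f and g with
   (f x - f y) (g x - g y) >= 0 for all x, y have partial derivatives of the
   same sign a.e.  On almost every line parallel to a coordinate axis, a weakly
   differentiable function agrees a.e. with a function that is a.e.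
   differentiable with the expected derivative; this is read off from test
   functions that tend to (t - a) (d - t) on the intervals ]a, d[. *)
Require Import Defs.
From HB Require Import structures.
From mathcomp Require Import all_boot all_order all_algebra.
From mathcomp Require Import all_classical all_reals all_analysis.
From mathcomp Require Import measurable_realfun ring lra.
Set Implicit Arguments.
Unset Strict Implicit.
Unset Printing Implicit Defensive.
Import Order.TTheory GRing.Theory Num.Theory.
Import numFieldNormedType.Exports.
Local Open Scope classical_set_scope.
Local Open Scope ring_scope.

(** * Absolutely continuous functions with vanishing derivative *)

(** The field [F] is accessible only through the weak gradients of the truncations [trunc k \o f],
    while [G] is a weak gradient of a truncation of [f - c]. Both truncations are nondecreasing
    functions of the same [f], so their increments between any two points have the same sign.
    Passing to derivatives along lines, one coordinate at a time, gives the sign of every product of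
    components, hence of [dot F G]. The obstacle is null sets: each test function excludes a null
    set of lines, so on a fixed line only countably many test functions are available. The intervals
    therefore keep their left end a and have rational right ends d. The polynomial (t - a)(d - t)
    suits this: it vanishes at both ends, so smooth approximations with uniformly bounded
    derivatives exist, and it is affine in d, so continuity recovers all real d and differentiation
    in d recovers the function itself. At the end, a derivative that vanishes almost everywhere
    yields constancy only together with absolute continuity, which the mass inherits from the curve
    because its increments are bounded by L^1 norms. *)

Section absolute_continuity.
Context {R : realType}.
Local Notation leb := (@lebesgue_measure R).

(** Finite additivity on the disjoint union, then monotonicity. Empty intervals with [s i = t i] are
    allowed and contribute 0. *)
Lemma sum_length_open (U : set R) k (s t : 'I_k -> R) :
  open U -> (forall i, s i <= t i) -> (forall i, `]s i, t i[ `<=` U) ->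
  trivIset setT (fun i => `]s i, t i[%classic) ->
  ((\sum_i (t i - s i))%:E <= leb U)%E.
Proof.
move=> oU st sU tI.
have mI i : measurable (`]s i, t i[%classic : set (measurableTypeR R)).
  exact: measurable_itv.
have mUI : measurable (\big[setU/set0]_(i < k)
    (`]s i, t i[%classic : set (measurableTypeR R))).
  exact: bigsetU_measurable.
have -> : (\sum_i (t i - s i))%:E = leb (\big[setU/set0]_(i < k) `]s i, t i[%classic).
  rewrite measure_semi_additive_ord// -sumEFin; apply: eq_bigr => i _.
  rewrite /= lebesgue_measure_itv /= lte_fin; case: ltP => [_|ti]; first by rewrite EFinB.
  by congr EFin; apply/eqP; rewrite subr_eq0 eq_le ti st.
apply: le_measure; rewrite ?inE//; first exact: open_measurable.
elim/big_ind : _ => [//|A B AU BU x [/AU|/BU]//|i _]; exact: sU.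
Qed.

(** The bound [e * (b - a + 1)] has two sources: slope at most e away from the exceptional set
    contributes [e * (b - a)], and the increments over short intervals around that set contribute e
    by absolute continuity. *)
Lemma absolutely_continuous_deriv0 (m : R -> R) (a b : R) : a < b ->
  (forall e, 0 < e -> exists2 d, 0 < d &
    forall (N : nat) (s t : 'I_N -> R),
      (forall i, [/\ a <= s i, s i <= t i & t i <= b]) ->
      trivIset setT (fun i => `]s i, t i[%classic) ->
      \sum_i (t i - s i) < d -> \sum_i `|m (t i) - m (s i)| < e) ->
  {ae leb, forall t, a < t < b ->
    (fun h => h^-1 * (m (t + h) - m t)) @ 0^' --> (0 : R)} ->
  m a = m b.
Proof.
move=> ab ac [N [mN N0 subN]].
suff le_e e : 0 < e -> `|m b - m a| <= e * (b - a + 1).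
  apply/esym/eqP; rewrite -subr_eq0 -normr_le0; apply/ler_addgt0Pl => e e0.
  have ba0 : 0 < b - a + 1 by rewrite addr_gt0// subr_gt0.
  by rewrite addr0 (le_trans (le_e (e / (b - a + 1)) _)) ?divr_gt0// divfK// gt_eqF.
move=> e0; have [d d0 acd] := ac _ e0.
(* The end points count as exceptional, so that a point of [[a, b]] outside [N'] lies in []a, b[],
   where the derivative is known. *)
pose N' := N `|` [set a] `|` [set b].
have mN' : measurable N' by do 2 apply: measurableU => //.
have N'0 : leb N' = 0%E.
  have mNa : measurable (N `|` [set a]) by exact: measurableU.
  have Na0 : leb (N `|` [set a]) = 0%E.
    by apply: null_set_setU => //; exact: lebesgue_measure_set1.
  by apply: null_set_setU => //; exact: lebesgue_measure_set1.
have [U [oU NU Ud]] : exists U : set R, [/\ open U, N' `<=` U & (leb U < d%:E)%E].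
  have N'oo : (leb N' < +oo)%E by rewrite N'0 ltry.
  have [U [oU NU Ud]] := @lebesgue_regularity_outer R N' d mN' N'oo d0.
  exists U; split => //.
  rewrite -(setDUK NU) measureU//; last exact: setDIK.
  - by rewrite [X in (X + _ < _)%E](_ : _ = 0%E)// add0e.
  - by apply: measurableD => //; exact: open_measurable.
(* Continuous induction on x: the null set of bad points is covered by the open
   set U of small measure, and steps inside U are paid for by the sum. *)
pose P x := exists k (s t : 'I_k -> R),
  [/\ forall i, [/\ a <= s i, s i <= t i & t i <= x],
      forall i, `]s i, t i[ `<=` U,
      trivIset setT (fun i => `]s i, t i[%classic) &
      `|m x - m a| <= e * (x - a) + \sum_i `|m (t i) - m (s i)|].
(* Every c can be jumped over, with one radius r for all y and z. If c is in [N'], the interval []y,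
   z[] joins the list; otherwise the increments from y to c and from c to z have slope at most e. *)
have Pext c : a <= c <= b -> exists2 r, 0 < r &
    forall y z, a <= y -> z <= b -> y <= c <= z -> c - r < y -> z < c + r -> P y -> P z.
  move=> /andP[ac' cb]; have [cN|cN] := pselect (N' c).
    have /nbhs_ballP[r /= r0 rU] : nbhs c U.
      by apply: open_nbhs_nbhs; split => //; exact: NU.
    exists r => // y z ay zb /andP[yc cz] cy zc [k [s [t [st sU tI hP]]]].
    pose s' (i : 'I_k.+1) := if unlift ord_max i is Some j then s j else y.
    pose t' (i : 'I_k.+1) := if unlift ord_max i is Some j then t j else z.
    exists k.+1, s', t'; split.
    - move=> i; rewrite /s' /t'; case: unlift => [j|]; last by split; lra.
      by have [? ? ?] := st j; split; lra.
    - move=> i; rewrite /s' /t'; case: unlift => [j|]; first exact: sU.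
      move=> x /=; rewrite in_itv/= => /andP[yx xz]; apply: rU; rewrite /ball/=.
      by rewrite ltr_norml; apply/andP; split; lra.
    - move=> i j _ _ [x []]; rewrite /s' /t' /= !in_itv/=.
      case: unliftP => [i' ->|->]; case: unliftP => [j' ->|->]//.
      + move=> h1 h2; congr lift; apply: tI => //.
        by exists x; split; rewrite /= in_itv.
      + have [_ _ ty] := st i' => /andP[_ xt] /andP[yx _].
        by move: (lt_le_trans (lt_trans yx xt) ty); rewrite ltxx.
      + have [_ _ ty] := st j' => /andP[yx _] /andP[_ xt].
        by move: (lt_le_trans (lt_trans yx xt) ty); rewrite ltxx.
    - rewrite big_ord_recr/= /s' /t' unlift_none.
      under eq_bigr => i _.
        rewrite (_ : widen_ord _ i = lift ord_max i); last first.
          by apply/val_inj; rewrite /= /bump leqNgt ltn_ord.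
        rewrite liftK; over.
      have -> : m z - m a = (m y - m a) + (m z - m y) by ring.
      apply: (le_trans (ler_normD _ _)).
      rewrite addrA lerD2r (le_trans hP)// lerD2r ler_pM2l//; lra.
  have abc : a < c < b.
    apply/andP; split; rewrite lt_neqAle ?ac' ?cb andbT; apply/eqP => ca; apply: cN.
      by left; right.
    by right.
  have cvg0 : (fun h => h^-1 * (m (c + h) - m c)) @ 0^' --> (0 : R).
    apply: contrapT => h; apply: cN; left; left; apply: subN => /= /(_ abc).
    by move/h.
  move/cvgrPdist_le : cvg0 => /(_ _ e0); rewrite near_withinE.
  move=> /nbhs_ballP[r /= r0 hr]; exists r => //.
  have hlip x : `|x - c| < r -> `|m x - m c| <= e * `|x - c|.
    have [->|xc] := eqVneq x c; first by rewrite !subrr normr0 mulr0.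
    move=> xr; have xc0 : x - c != 0 by rewrite subr_eq0.
    have := hr (x - c); rewrite /ball/= sub0r normrN => /(_ xr xc0).
    rewrite sub0r normrN (addrC c) subrK normrM normfV mulrC ler_pdivrMr ?normr_gt0//.
  move=> y z ay zb /andP[yc cz] cy zc [k [s [t [st sU tI hP]]]].
  exists k, s, t; split => //.
    by move=> i; have [? ? ?] := st i; split; lra.
  have -> : m z - m a = (m y - m a) + (m z - m c) - (m y - m c) by ring.
  apply: (le_trans (ler_normB _ _)); apply: (le_trans (lerD (ler_normD _ _) (lexx _))).
  have h1 : `|m z - m c| <= e * (z - c).
    by have := hlip z; rewrite ger0_norm ?subr_ge0//; apply; lra.
  have h2 : `|m y - m c| <= e * (c - y).
    by have := hlip y; rewrite ler0_norm ?subr_le0// opprB; apply; lra.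
  apply: (le_trans (lerD (lerD hP h1) h2)); nra.
pose A := [set x | a <= x <= b /\ P x].
have Aa : A a.
  split; first by rewrite lexx ltW.
  exists 0%N, (fun=> 0), (fun=> 0); split => [[]//|[]//|[]//|].
  by rewrite !subrr normr0 mulr0 big_ord0 add0r.
have hA : has_sup A by split; [exists a|exists b => x [/andP[]]].
pose c := sup A.
have ac' : a <= c by apply: ub_le_sup => //; case: hA.
have cb : c <= b by apply: ge_sup; [exists a|move=> x [/andP[]]].
have [|r r0 hr] := Pext c; first by rewrite ac' cb.
have [y [/andP[ay yb] Py] cy] := sup_adherent r0 hA.
have yc : y <= c by apply: ub_le_sup; [case: hA|split => //; rewrite ay yb].
(* [Pext] at the supremum c carries [P] to z; maximality then gives z <= c, which excludes c + r / 2
   and leaves z = b. *)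
pose z := Num.min b (c + r / 2).
have cz : c <= z by rewrite /z le_min cb/=; lra.
have zb : z <= b by rewrite /z ge_min lexx.
have zr : z < c + r by rewrite /z gt_min; apply/orP; right; lra.
have Pz : P z by apply: (hr y z) => //; rewrite yc cz.
have zc : z <= c.
  by apply: ub_le_sup; [case: hA|split => //; rewrite zb (le_trans ac' cz)].
have zE : z = b.
  by move: zc; rewrite /z ge_min => /orP[?|?]; [apply/min_idPl; lra|lra].
move: Pz; rewrite zE => -[k [s [t [st sU tI hP]]]].
apply: (le_trans hP); rewrite (mulrDr e (b - a) 1) mulr1 lerD2l ltW//; apply: acd => //.
rewrite -lte_fin; apply: le_lt_trans Ud; apply: sum_length_open => // i.
by have [] := st i.
Qed.

End absolute_continuity.

(** * Boxes and Lebesgue measure on R^n *)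

Section open_boxes.
Context {R : realType} {n : nat}.
Implicit Types a b : 'rV[R]_n.

Definition obox a b : set 'rV[R]_n := [set v | forall i, a 0 i < v 0 i < b 0 i].

Definition oboxes : set (set 'rV[R]_n) := [set obox ab.1 ab.2 | ab in setT].

Lemma measurable_obox a b : measurable (obox a b).
Proof.
rewrite (_ : obox a b = \bigcap_(i in setT)
    ((fun v : 'rV[R]_n => v 0 i) @^-1` `]a 0 i, b 0 i[%classic)).
  apply: fin_bigcap_measurable => // i _; rewrite -[X in measurable X]setTI.
  by apply: measurable_coord => //; exact: measurable_itv.
apply/seteqP; split => [v /= h i _|v h i]; first by rewrite /= in_itv; exact: h.
by have := h i Logic.I; rewrite /= in_itv.
Qed.

Lemma measurable_oboxes : @measurable _ 'rV[R]_n = <<s oboxes>>.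
Proof.
apply/seteqP; split; last first.
  apply: smallest_sub; first exact: sigma_algebra_measurable.
  by move=> _ [[a b] _ <-]; exact: measurable_obox.
apply: smallest_sub; first exact: smallest_sigma_algebra.
move=> U oU; have [B ->] := open_rV_boxes oU.
change (@measurable _ (g_sigma_algebraType oboxes) (\bigcup_(qk in B)
  [set v | forall i, ball (ratr (qk.1 0 i) : R) qk.2.+1%:R^-1 (v 0 i)])).
rewrite bigcup_mkcond; apply: countable_bigcupT_measurable => // qk.
case: ifPn => _; last exact: measurable0.
apply: sub_sigma_algebra.
exists (\row_i (ratr (qk.1 0 i) - qk.2.+1%:R^-1), \row_i (ratr (qk.1 0 i) + qk.2.+1%:R^-1)) => //=.
by apply/seteqP; split => v /= h i; have := h i; rewrite !mxE ball_itv/= in_itv.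
Qed.

Lemma setI_closed_oboxes : setI_closed oboxes.
Proof.
move=> _ _ [[a b] _ <-] [[c d] _ <-]; exists (\row_i Num.max (a 0 i) (c 0 i),
  \row_i Num.min (b 0 i) (d 0 i)) => //=.
apply/seteqP; split => [v /= h|v /= [h1 h2] i].
  by split=> i; have := h i; rewrite !mxE gt_max lt_min
    => /andP[/andP[ha hc] /andP[hb hd]]; apply/andP; split.
rewrite !mxE gt_max lt_min.
by have /andP[-> ->] := h1 i; have /andP[-> ->] := h2 i.
Qed.

Lemma bigcup_obox : \bigcup_k obox (const_mx (- k%:R)) (const_mx k%:R) = setT.
Proof.
apply/seteqP; split => // v _.
exists (Num.bound (\sum_i `|v 0 i|)) => //= i; rewrite !mxE -ltr_norml.
apply: le_lt_trans (archi_boundP _); last by rewrite sumr_ge0.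
by rewrite (bigD1 i)//= lerDl sumr_ge0.
Qed.

Lemma measure_unique_obox (m1 m2 : {measure set 'rV[R]_n -> \bar R}) :
  (forall a b, m1 (obox a b) = m2 (obox a b)) ->
  (forall a b, (m1 (obox a b) < +oo)%E) ->
  forall A, measurable A -> m1 A = m2 A.
Proof.
move=> m12 moo A mA; apply: (measure_unique oboxes
  (fun k => obox (const_mx (- k%:R)) (const_mx k%:R))) => //.
- exact: measurable_oboxes.
- exact: setI_closed_oboxes.
- by move=> k; exists (const_mx (- k%:R), const_mx k%:R).
- exact: bigcup_obox.
- by move=> _ [[a b] _ <-]; exact: m12.
Qed.

End open_boxes.

Section density.
Context d (T : measurableType d) (R : realType) (mu : {measure set T -> \bar R}).
Variables (f : T -> \bar R) (mf : measurable_fun setT f) (f0 : forall x, (0 <= f x)%E).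

(* The proofs are arguments so that the measure instance below can be inferred. *)
Definition density of measurable_fun setT f & (forall x, 0 <= f x)%E :=
  fun A => (\int[mu]_(x in A) f x)%E.

Let density0 : density mf f0 set0 = 0%E. Proof. exact: integral_set0. Qed.
Let density_ge0 A : (0 <= density mf f0 A)%E. Proof. exact: integral_ge0. Qed.
Let density_sigma_additive : semi_sigma_additive (density mf f0).
Proof. exact: semi_sigma_additive_nng_induced. Qed.

HB.instance Definition _ := isMeasure.Build _ _ _ (density mf f0)
  density0 density_ge0 density_sigma_additive.

End density.

Section fundamental_lemma.
Context {R : realType} {n : nat}.
Variable mu : {measure set 'rV[R]_n -> \bar R}.

(** The positive and the negative part of g are densities of two measures that agree on open boxes,
    hence on all measurable sets; so g has integral 0 over every measurable set. *)
Lemma ae_eq0_obox (g : 'rV[R]_n -> \bar R) : mu.-integrable setT g ->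
  (forall a b, \int[mu]_(x in obox a b) g x = 0)%E ->
  {ae mu, forall x, g x = 0%E}.
Proof.
move=> ig g0; have mg := measurable_int _ ig.
have iS A : measurable A -> mu.-integrable A g.
  by move=> mA; exact: integrableS ig.
have iO a b : mu.-integrable (obox a b) g by apply: iS; exact: measurable_obox.
pose m1 := density mu (measurable_funepos mg) (funepos_ge0 g).
pose m2 := density mu (measurable_funeneg mg) (funeneg_ge0 g).
have m12 : forall A, measurable A -> m1 A = m2 A.
  apply: measure_unique_obox => a b.
    have := g0 a b; rewrite integralE => /eqP; rewrite sube_eq ?add0e.
    - by move/eqP.
    - by apply: integrable_pos_fin_num; first [exact: iO|exact: measurable_obox].
    - by rewrite fin_num_adde_defl//; apply: integrable_neg_fin_num; first [exact: iO|exact: measurable_obox].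
  rewrite ltey_eq; apply/orP; left.
  by apply: integrable_pos_fin_num; first [exact: iO|exact: measurable_obox].
have : ae_eq mu setT g (cst 0%E).
  apply: integral_ae_eq => // A _ mA; rewrite integral_cst// mul0e integralE.
  have := m12 A mA; rewrite /m1 /m2 /density => ->.
  by rewrite subee//; apply: integrable_neg_fin_num => //; exact: iS.
by apply: filterS => x /=; apply.
Qed.

End fundamental_lemma.

Lemma prod_lift (R : comPzRingType) n (i : 'I_n.+1) (F : 'I_n.+1 -> R) :
  \prod_j F j = F i * \prod_(k < n) F (lift i k).
Proof. exact: (bigD1_ord i). Qed.

(** * Splitting off one coordinate and Fubini along coordinate lines *)

Section insert_coordinate.
Context {R : realType} {n : nat}.
Variable i : 'I_n.+1.
Local Notation leb1 := (@lebesgue_measure R).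

(** The lines parallel to axis i are the curves t |-> [ins (t, x)]; [cons_rV], through which the
    measure is built, is the case i = 0. *)
Definition ins (z : measurableTypeR R * 'rV[R]_n) : 'rV[R]_n.+1 :=
  \row_j (if unlift i j is Some k then z.2 0 k else z.1).

Lemma ins_id z : ins z 0 i = z.1.
Proof. by rewrite mxE unlift_none. Qed.

Lemma ins_lift z k : ins z 0 (lift i k) = z.2 0 k.
Proof. by rewrite mxE liftK. Qed.

Lemma measurable_ins : measurable_fun setT ins.
Proof.
apply: measurable_fun_rV => j; under eq_fun do rewrite mxE.
case: unlift => [k|]; last exact: measurable_fst.
exact: (measurableT_comp (measurable_coord k) measurable_snd).
Qed.

Lemma preimage_ins_obox (a b : 'rV[R]_n.+1) : ins @^-1` obox a b =
  (`]a 0 i, b 0 i[%classic : set (measurableTypeR R)) `*`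
  obox (\row_k a 0 (lift i k)) (\row_k b 0 (lift i k)).
Proof.
apply/seteqP; split => [[t x] /= h|[t x] /= [h h'] j].
  split => [|k /=]; first by have := h i; rewrite ins_id in_itv.
  by have := h (lift i k); rewrite ins_lift !mxE.
have [k ->|->] := unliftP i j; first by have := h' k; rewrite ins_lift !mxE.
by move: h; rewrite ins_id in_itv.
Qed.

End insert_coordinate.

Section lebesgue_insert.
Context {R : realType}.
Local Notation leb1 := (@lebesgue_measure R).

(** The maximum with 0 accounts for empty boxes, so that measures can be compared on the whole of
    [oboxes]. *)
Lemma lebesgue_rV_obox n (a b : 'rV[R]_n) :
  lebesgue_rV R n (obox a b) = (\prod_i Num.max 0 (b 0 i - a 0 i))%:E.
Proof.
elim: n a b => [|n IH] a b; first by rewrite /= big_ord0 diracE mem_set// => -[].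
have insE : @cons_rV R n = ins ord0.
  apply/funext => z; apply/rowP => j; have [k ->|->] := unliftP ord0 j.
    by rewrite cons_rVS ins_lift.
  by rewrite cons_rV0 ins_id.
have := preimage_ins_obox ord0 a b; rewrite -insE => boxE.
rewrite [LHS](congr1 _ boxE) product_measure1E//=; last exact: measurable_obox.
rewrite IH lebesgue_measure_itv/= lte_fin (prod_lift ord0)/=.
under eq_bigr => k _ do rewrite !mxE.
case: ltP => [ab|ba].
  by rewrite -EFinB -EFinM max_r// subr_ge0 ltW.
by rewrite mul0e max_l ?subr_le0// mul0r.
Qed.

Variables (n : nat) (i : 'I_n.+1).
Local Notation lebn := (lebesgue_rV R n).

Let ins_measure : {measure set 'rV[R]_n.+1 -> \bar R} :=
  measure_function_pushforward__canonical__measure_function_Measure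
    (leb1 \x lebn)%E (@measurable_ins R n i).

(** The product of the side lengths of a box does not depend on which factor is split off, so the
    two measures agree on boxes, which determine them. *)
Lemma pushforward_ins A : measurable A ->
  pushforward (leb1 \x lebn)%E (ins i) A = lebesgue_rV R n.+1 A.
Proof.
have insoo a b : (ins_measure (obox a b) = lebesgue_rV R n.+1 (obox a b))%E.
  rewrite lebesgue_rV_obox /ins_measure /= /pushforward preimage_ins_obox.
  rewrite product_measure1E//; last exact: measurable_obox.
  rewrite [X in (_ * X)%E]lebesgue_rV_obox /= lebesgue_measure_itv/= lte_fin (prod_lift i)/=.
  under [in LHS]eq_bigr => k _ do rewrite !mxE.
  case: ltP => [ab|ba].
    by rewrite -EFinB -EFinM max_r// subr_ge0 ltW.
  by rewrite mul0e max_l ?subr_le0// mul0r.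
move=> mA; apply: (@measure_unique_obox _ _ ins_measure (lebesgue_rV R n.+1)) => // a b.
by rewrite insoo lebesgue_rV_obox ltry.
Qed.

Lemma integrable_ins (f : 'rV[R]_n.+1 -> \bar R) :
  (lebesgue_rV R n.+1).-integrable setT f ->
  (leb1 \x lebn)%E.-integrable setT (f \o ins i).
Proof.
move=> /integrableP[mf foo]; apply/integrableP; split.
  by apply: measurableT_comp => //; exact: measurable_ins.
have := ge0_integral_pushforward (@measurable_ins R n i) (leb1 \x lebn)%E measurableT
  (measurableT_comp (@abse_measurable R setT) mf) (fun _ _ => abse_ge0 _).
rewrite preimage_setT => /= <-.
by rewrite (@eq_measure_integral _ _ _ _ (lebesgue_rV R n.+1) ins_measure)// => A mA _; exact: pushforward_ins.
Qed.

Lemma integral_ins (f : 'rV[R]_n.+1 -> \bar R) :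
  (lebesgue_rV R n.+1).-integrable setT f ->
  (\int[lebn]_x \int[leb1]_t f (ins i (t, x)) = \int[lebesgue_rV R n.+1]_v f v)%E.
Proof.
move=> fi; have fi' := integrable_ins fi.
have mf := measurable_int _ fi.
have /= := integral_pushforward (@measurable_ins R n i) mf fi' measurableT.
rewrite preimage_setT => h.
rewrite -(@eq_measure_integral _ _ _ _ (lebesgue_rV R n.+1) ins_measure)//; last first.
  by move=> A mA _; exact: pushforward_ins.
by rewrite h -integral21_prod_meas1.
Qed.

Lemma integrable_slice_integral (f : 'rV[R]_n.+1 -> \bar R) :
  (lebesgue_rV R n.+1).-integrable setT f ->
  lebn.-integrable setT (fun x => \int[leb1]_t f (ins i (t, x)))%E.
Proof.
move=> fi; have fi' := integrable_ins fi; have mf' := measurable_int _ fi'.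
have mslice x : measurable_fun setT (fun t => f (ins i (t, x))).
  exact: (measurableT_comp mf' (measurable_pair2 x)).
apply/integrableP; split; first exact: (measurable_fubini_G fi').
have foo : (\int[lebn]_x \int[leb1]_t `|f (ins i (t, x))| < +oo)%E.
  exact: (integrable21ltyP leb1 lebn mf').1 fi'.
apply: le_lt_trans foo.
apply: ge0_le_integral => //.
- by apply: measurableT_comp => //; exact: (measurable_fubini_G fi').
- have mabs : measurable_fun setT (abse \o (f \o ins i)) by exact: measurableT_comp.
  apply: (measurable_fun_fubini_tonelli_G _ mabs) => z; exact: abse_ge0.
- by move=> x _; exact: le_abse_integral.
Qed.

(** Tonelli for the indicator of the complement of P: for almost every x its integral along the line
    vanishes. Measurability of P is what makes this indicator admissible. *)
Lemma ae_ins (P : set 'rV[R]_n.+1) : measurable P ->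
  {ae lebn, forall x, {ae leb1, forall t, P (ins i (t, x))}} ->
  {ae lebesgue_rV R n.+1, forall v, P v}.
Proof.
move=> mP aeP; exists (~` P); split => //; first exact: measurableC.
have mPC := measurableC mP.
have mPi : measurable (ins i @^-1` (~` P)).
  by rewrite -[X in measurable X]setTI; exact: measurable_ins.
pose f (z : measurableTypeR R * 'rV[R]_n) : \bar R := (\1_(ins i @^-1` (~` P)) z)%:E.
have mf : measurable_fun setT f by apply/measurable_EFinP.
have f0 z : (0 <= f z)%E by rewrite lee_fin.
rewrite [LHS](_ : _ = \int[leb1 \x lebn]_z f z)%E; last first.
  by rewrite integral_indic// setIT -pushforward_ins.
rewrite fubini_tonelli2//.
apply/eqP; rewrite -(@integral0 _ _ _ lebn setT); apply/eqP.
apply: ae_eq_integral => //; first exact: measurable_fun_fubini_tonelli_G.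
move: aeP; apply: filterS => x Px _ /=; rewrite /fubini_G.
apply/eqP; rewrite -(@integral0 _ _ _ leb1 setT); apply/eqP.
apply: ae_eq_integral => //; first exact: measurableT_comp.
by move: Px; apply: filterS => t Pt _; rewrite /f indicE memNset.
Qed.

End lebesgue_insert.

(** * Smooth cutoff functions *)

Section smooth1.
Context {R : realType}.
Implicit Types (f g : R -> R).

Fixpoint Ck (k : nat) f : Prop :=
  if k is k'.+1 then (forall x, derivable f x 1) /\ Ck k' f^`()%classic else continuous f.

Definition smooth1 f := forall k, Ck k f.

Lemma derivable_continuous1 f : (forall x, derivable f x 1) -> continuous f.
Proof. by move=> df x; exact/differentiable_continuous/derivable1_diffP. Qed.

Lemma CkW k f : Ck k.+1 f -> Ck k f.
Proof.
elim: k f => [f [df _]|k IH f [df cf]]; first exact: derivable_continuous1.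
by split => //; exact: IH.
Qed.

Lemma smooth1_derivable f (x : R) : smooth1 f -> derivable f x 1.
Proof. by move=> /(_ 1%N) []. Qed.

Lemma smooth1_continuous f : smooth1 f -> continuous f.
Proof. by move=> /(_ 0%N). Qed.

Lemma smooth1_derive1 f : smooth1 f -> smooth1 f^`()%classic.
Proof. by move=> sf k; have [] := sf k.+1. Qed.

Lemma derive1_eq f (x df : R) : is_derive x 1 f df -> f^`()%classic x = df.
Proof. by move=> h; rewrite derive1E derive_val. Qed.

Lemma is_derive_derive1 f (x : R) : derivable f x 1 -> is_derive x 1 f (f^`()%classic x).
Proof. by move=> df; rewrite derive1E; exact: derivableP. Qed.

Lemma CkD k f g : Ck k f -> Ck k g -> Ck k (f \+ g).
Proof.
elim: k f g => [f g cf cg x|k IH f g [df cf] [dg cg]]; first exact: cvgD (cf x) (cg x).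
split; first by move=> x; exact: derivableD.
rewrite (_ : (f \+ g)^`()%classic = f^`()%classic \+ g^`()%classic); first exact: IH.
apply/funext => x; apply: derive1_eq.
by have := is_derive_derive1 (df x); have := is_derive_derive1 (dg x) => ? ?; exact: is_deriveD.
Qed.

Lemma CkM k f g : Ck k f -> Ck k g -> Ck k (f \* g).
Proof.
elim: k f g => [f g cf cg x|k IH f g Cf Cg]; first exact: cvgM (cf x) (cg x).
have [df cf] := Cf; have [dg cg] := Cg.
split; first by move=> x; exact: derivableM.
rewrite (_ : (f \* g)^`()%classic = (f^`()%classic \* g) \+ (f \* g^`()%classic)).
  by apply: CkD; apply: IH => //; exact: CkW.
apply/funext => x; apply: derive1_eq.
have := is_derive_derive1 (df x); have := is_derive_derive1 (dg x) => ? ?.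
apply: is_derive_eq; rewrite /= /GRing.scale /=; ring.
Qed.

Lemma Ck_cst k (c : R) : Ck k (cst c).
Proof.
elim: k c => [c|k IH c]; first exact: cst_continuous.
split; first by move=> x; exact: derivable_cst.
by rewrite (_ : (cst c : R -> R)^`()%classic = cst 0)//; apply/funext => x; rewrite derive1_cst.
Qed.

Lemma Ck_id k : Ck k (@id R).
Proof.
case: k => [|k]; first by move=> x; exact: cvg_id.
split; first by move=> x; exact: derivable_id.
rewrite (_ : (@id R)^`()%classic = cst 1); first exact: Ck_cst.
by apply/funext => x; rewrite derive1E derive_id.
Qed.

Lemma is_derive_affine (a b x : R) : is_derive x 1 (fun y : R => a * y + b) a.
Proof. by apply: is_derive_eq; rewrite /GRing.scale/= mulr1 addr0. Qed.

Lemma is_derive_comp_affine f (a b x : R) : derivable f (a * x + b) 1 ->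
  is_derive x 1 (fun y => f (a * y + b)) (a * f^`()%classic (a * x + b)).
Proof.
move=> df; have h := is_derive_affine a b x.
have h' := is_derive_derive1 df.
have := @is_derive1_comp _ f (fun y : R => a * y + b) x _ _ h' h.
by rewrite mulrC.
Qed.

Lemma Ck_affine k f (a b : R) : Ck k f -> Ck k (fun x => f (a * x + b)).
Proof.
elim: k f => [f cf x|k IH f [df cf]].
  apply: (@continuous_comp _ _ _ (fun x : R => a * x + b) f); last exact: cf.
  by apply: cvgD; [exact: mulrl_continuous|exact: cvg_cst].
split; first by move=> x; have [] := is_derive_comp_affine (df (a * x + b)).
rewrite (_ : (fun x => f (a * x + b))^`()%classic = cst a \* (fun x => f^`()%classic (a * x + b))).
  by apply: CkM; [exact: Ck_cst|exact: IH].
by apply/funext => x; apply: derive1_eq; exact: is_derive_comp_affine.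
Qed.

Lemma smooth1M f g : smooth1 f -> smooth1 g -> smooth1 (f \* g).
Proof. by move=> sf sg k; exact: CkM. Qed.

Lemma smooth1_affine f a b : smooth1 f -> smooth1 (fun x => f (a * x + b)).
Proof. by move=> sf k; exact: Ck_affine. Qed.

(** The case k = 0 is the classical exp(-1/t). The powers of 1/t make the family stable under
    differentiation, up to linear combinations, so smoothness follows by induction on the order for
    all k at once. *)
Definition flat (k : nat) (t : R) : R :=
  if 0 < t then t^-1 ^+ k * expR (- t^-1) else 0.

Lemma exprn_le_expR k (s : R) : 0 <= s -> s ^+ k <= k`!%:R * expR s.
Proof.
case: k => [s0|k s0]; first by rewrite expr0 fact0 mul1r; apply: le_trans (expR_ge1Dx s); rewrite lerDl.
rewrite mulrC -ler_pdivrMr ?ltr0n ?fact_gt0//; apply: le_trans (expR_ge1Dxn k s0).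
by rewrite lerDr.
Qed.

Lemma flat_le k t : 0 <= flat k t <= k`!%:R.
Proof.
rewrite /flat; case: ifPn => t0; last by rewrite lexx ler0n.
have ti : 0 <= t^-1 by rewrite invr_ge0 ltW.
rewrite mulr_ge0 ?exprn_ge0 ?expR_ge0//= expRN ler_pdivrMr ?expR_gt0//.
exact: exprn_le_expR.
Qed.

Lemma flatS_id k t : t * flat k.+1 t = flat k t.
Proof.
rewrite /flat; case: ifPn => t0; last by rewrite mulr0.
by rewrite exprS !mulrA divff ?mul1r// gt_eqF.
Qed.

Lemma is_derive_flat k (t : R) : is_derive t 1 (flat k) (flat k.+2 t - k%:R * flat k.+1 t).
Proof.
have [t0|t0|->] := ltgtP t 0.
- rewrite /flat ltNge (ltW t0)/= mulr0 subrr.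
  apply: (@near_eq_is_derive _ _ _ (cst 0)) => //.
  near=> y; rewrite /= ltNge ltW//; near: y; exact: lt_nbhsl.
- pose f y : R := y^-1 ^+ k * expR (- y^-1).
  have tn0 : t != 0 by rewrite gt_eqF.
  apply: (@near_eq_is_derive _ _ _ f) => //.
    near=> y; rewrite /flat ifT//; near: y; exact: lt_nbhsr.
  have dV : is_derive t 1 (@GRing.inv R) (- t^-1 ^+ 2).
    have h := @is_deriveV R id t 1 1 tn0 (is_derive_id t 1).
    by apply: (is_derive_eq h); rewrite /GRing.scale/= mulr1 exprVn.
  have dX : is_derive t 1 (fun y : R => y^-1 ^+ k) (- (k%:R * t^-1 ^+ k.+1)).
    have h : is_derive t^-1 1 (fun y : R => y ^+ k) (k%:R * t^-1 ^+ k.-1).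
      apply: DeriveDef; first exact: exprn_derivable.
      by rewrite exp_derive /GRing.scale/= mulr1.
    apply: (is_derive_eq (is_derive1_comp h dV)).
    by case: (k) => [|k'] /=; rewrite !exprS !expr0; ring.
  have dE : is_derive t 1 (fun y : R => expR (- y^-1)) (t^-1 ^+ 2 * expR (- t^-1)).
    have dN : is_derive t 1 (fun y : R => - y^-1) (t^-1 ^+ 2).
      by have h := is_deriveN dV; apply: (is_derive_eq h); rewrite opprK.
    have := @is_derive1_comp _ (@expR R) (fun y : R => - y^-1) t _ _ (is_derive_expR _) dN.
    by rewrite mulrC.
  apply: is_derive_eq; rewrite /flat t0 /GRing.scale/= !exprS; ring.
- rewrite /flat ltxx mulr0 subrr.
  have key : (fun h : R => h^-1 *: (flat k (h *: 1 + 0) - flat k 0)) @ 0^' --> (0 : R).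
    apply/cvgrPdist_le => e e0; near=> h.
    have hn0 : h != 0 by near: h; exact: nbhs_dnbhs_neq.
    rewrite sub0r normrN addr0 /GRing.scale/= mulr1 [flat k 0]/flat ltxx subr0.
    rewrite [h^-1 * _](_ : _ = h * flat k.+2 h); last first.
      by rewrite -flatS_id -[flat k.+1 h]flatS_id mulKf.
    have /andP[f0 f1] := flat_le k.+2 h.
    rewrite normrM (ger0_norm f0).
    apply: (@le_trans _ _ (`|h| * (k.+2)`!%:R)); first by rewrite ler_wpM2l.
    rewrite -ler_pdivlMr ?ltr0n ?fact_gt0//.
    near: h; apply: dnbhs0_le; rewrite divr_gt0 ?ltr0n ?fact_gt0//.
  by apply: DeriveDef; [apply/cvg_ex; exists 0|exact/cvg_lim].
Unshelve. all: by end_near. Qed.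

Lemma smooth1_flat k : smooth1 (flat k).
Proof.
move=> j; elim: j k => [|j IH] k.
  by apply: derivable_continuous1 => x; have [] := is_derive_flat k x.
split; first by move=> x; have [] := is_derive_flat k x.
rewrite (_ : (flat k)^`()%classic = flat k.+2 \+ (cst (- k%:R) \* flat k.+1)).
  by apply: CkD => //; apply: CkM => //; exact: Ck_cst.
apply/funext => x; rewrite (derive1_eq (is_derive_flat k x)) /=; ring.
Qed.

End smooth1.

(** * Smooth approximations of (t - a)(d - t) and of interval indicators *)

Section bells.
Context {R : realType}.
Implicit Types (m : nat) (s t a d : R).

(* ramp m is smooth and tends to t^+, while its derivative dramp m is bounded
   uniformly in m because s * (flat 0)' s = flat 1 s. *)
Definition ramp m t : R := t * flat 0 (m%:R * t).
Definition dramp m t : R := flat 0 (m%:R * t) + flat 1 (m%:R * t).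

Lemma flat_le0 k t : t <= 0 -> flat k t = 0.
Proof. by move=> t0; rewrite /flat ltNge t0. Qed.

Lemma flat01 t : 0 <= flat 0 t <= 1.
Proof. by have := flat_le 0 t; rewrite fact0. Qed.

Lemma flat1_01 t : 0 <= flat 1 t <= 1.
Proof. by have := flat_le 1 t. Qed.

Lemma cvg_natr_mulV t : 0 < t -> (fun m => (m%:R * t)^-1) @ \oo --> (0 : R).
Proof.
move=> t0; rewrite (_ : (fun m => _) = (fun m => m%:R^-1 * t^-1)); last first.
  by apply/funext => m; rewrite invfM.
rewrite -(mul0r t^-1); apply: cvgMl; apply/gtr0_cvgV0; last exact: cvgr_idn.
by near=> m; rewrite ltr0n; near: m; exact: nbhs_infty_gt.
Unshelve. all: by end_near. Qed.

Lemma cvg_flat0 t : flat 0 (m%:R * t) @[m --> \oo] --> ((0 < t)%R%:R : R).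
Proof.
have [t0|t0] := ltP 0 t; last first.
  rewrite (_ : (fun m => _) = cst 0); first exact: cvg_cst.
  by apply/funext => m; rewrite flat_le0// mulr_ge0_le0.
have h : expR (- (m%:R * t)^-1) @[m --> \oo] --> (1 : R).
  rewrite -[X in _ --> X]expR0 -oppr0; apply: continuous_cvg; first exact: continuous_expR.
  by apply: cvgN; exact: cvg_natr_mulV.
apply: cvg_trans h; apply: near_eq_cvg; near=> m.
rewrite /flat expr0 mul1r ifT// mulr_gt0// ltr0n; near: m; exact: nbhs_infty_gt.
Unshelve. all: by end_near. Qed.

Lemma cvg_flat1 t : flat 1 (m%:R * t) @[m --> \oo] --> (0 : R).
Proof.
have [t0|t0] := ltP 0 t; last first.
  rewrite (_ : (fun m => _) = cst 0); first exact: cvg_cst.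
  by apply/funext => m; rewrite flat_le0// mulr_ge0_le0.
apply: (@squeeze_cvgr _ _ _ _ (cst 0) (fun m => (m%:R * t)^-1)).
- near=> m; have m0 : 0 < m%:R * t.
    by rewrite mulr_gt0// ltr0n; near: m; exact: nbhs_infty_gt.
  have /andP[-> _] := flat1_01 (m%:R * t); rewrite /= /flat m0 expr1.
  apply: ler_piMr; first by rewrite invr_ge0 ltW.
  by rewrite -[leRHS]expR0 ler_expR oppr_le0 invr_ge0 ltW.
- exact: cvg_cst.
- exact: cvg_natr_mulV.
Unshelve. all: by end_near. Qed.

Lemma cvg_ramp t : ramp m t @[m --> \oo] --> t * (0 < t)%R%:R.
Proof. by apply: cvgMr; exact: cvg_flat0. Qed.

Lemma cvg_dramp t : dramp m t @[m --> \oo] --> ((0 < t)%R%:R : R).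
Proof. by rewrite -[X in _ --> X]addr0; apply: cvgD; [exact: cvg_flat0|exact: cvg_flat1]. Qed.

Lemma ramp_le m t : `|ramp m t| <= `|t|.
Proof.
have /andP[f0 f1] := flat01 (m%:R * t).
by rewrite normrM ler_piMr// ger0_norm.
Qed.

Lemma dramp_le m t : `|dramp m t| <= 2.
Proof.
have /andP[f0 f1] := flat01 (m%:R * t); have /andP[g0 g1] := flat1_01 (m%:R * t).
rewrite ger0_norm ?addr_ge0//; exact: lerD.
Qed.

Lemma smooth1_ramp m : smooth1 (@ramp m).
Proof.
apply: smooth1M; first by move=> k; exact: Ck_id.
by under eq_fun do rewrite -[X in flat _ X]addr0; apply: smooth1_affine; exact: smooth1_flat.
Qed.

Lemma is_derive_ramp m t : is_derive t 1 (@ramp m) (dramp m t).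
Proof.
have df : is_derive t 1 (fun s => flat 0 (m%:R * s)) (m%:R * flat 2 (m%:R * t)).
  under eq_fun do rewrite -[X in flat _ X]addr0.
  have dfl : derivable (flat 0) (m%:R * t + 0) 1 by have [] := is_derive_flat 0 (m%:R * t + 0).
  apply: (is_derive_eq (is_derive_comp_affine dfl)).
  by rewrite (derive1_eq (is_derive_flat _ _)) mul0r subr0 addr0.
have di := is_derive_id t (1 : R).
apply: (is_derive_eq (is_deriveM di df)).
rewrite /GRing.scale/= mulr1 mulrA (mulrC t) flatS_id addrC //.
Qed.

(** Tends to (t - a)(d - t) on []a, d[] and to 0 elsewhere, while its derivative [dhat] stays
    bounded on [[a, d]] uniformly in m, as dominated convergence requires. *)
Definition hat m a d t := ramp m (t - a) * ramp m (d - t).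
Definition dhat m a d t := dramp m (t - a) * ramp m (d - t) - ramp m (t - a) * dramp m (d - t).

Lemma smooth1_hat m a d : smooth1 (hat m a d).
Proof.
apply: smooth1M.
  under eq_fun do rewrite -[X in X - a]mul1r.
  exact: (smooth1_affine 1 (- a) (@smooth1_ramp m)).
rewrite (_ : (fun x => _) = (fun x => ramp m (-1 * x + d))).
  exact: smooth1_affine (@smooth1_ramp m).
by apply/funext => x; rewrite mulN1r addrC.
Qed.

Lemma derive1_hat m a d : (hat m a d)^`()%classic = dhat m a d.
Proof.
apply/funext => t; apply: derive1_eq.
have d1 : is_derive t 1 (fun s => ramp m (s - a)) (dramp m (t - a)).
  rewrite (_ : (fun s => _) = (fun s => ramp m (1 * s + - a))); last first.
    by apply/funext => s; rewrite mul1r.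
  have h : derivable (@ramp m) (1 * t + - a) 1 by have [] := is_derive_ramp m (1 * t + - a).
  apply: (is_derive_eq (is_derive_comp_affine h)).
  by rewrite (derive1_eq (is_derive_ramp _ _)) !mul1r.
have d2 : is_derive t 1 (fun s => ramp m (d - s)) (- dramp m (d - t)).
  rewrite (_ : (fun s => _) = (fun s => ramp m (-1 * s + d))); last first.
    by apply/funext => s; rewrite mulN1r addrC.
  have h : derivable (@ramp m) (-1 * t + d) 1 by have [] := is_derive_ramp m (-1 * t + d).
  apply: (is_derive_eq (is_derive_comp_affine h)).
  by rewrite (derive1_eq (is_derive_ramp _ _)) !mulN1r addrC.
apply: (is_derive_eq (is_deriveM d1 d2)).
rewrite /GRing.scale/= /dhat; ring.
Qed.

(** Approximates the indicator of []a, d[]. It serves in the directions in which the test function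
    is not differentiated, so a uniform bound on [bell] itself suffices. *)
Definition bell m a d t := flat 0 (m%:R * (t - a)) * flat 0 (m%:R * (d - t)).

Lemma smooth1_bell m a d : smooth1 (bell m a d).
Proof.
apply: smooth1M.
  rewrite (_ : (fun t => _) = (fun t => flat 0 (m%:R * t + (- m%:R * a)))).
    exact: smooth1_affine (smooth1_flat 0).
  by apply/funext => t; congr flat; ring.
rewrite (_ : (fun t => _) = (fun t => flat 0 (- m%:R * t + m%:R * d))).
  exact: smooth1_affine (smooth1_flat 0).
by apply/funext => t; congr flat; ring.
Qed.

Lemma bell_le m a d t : `|bell m a d t| <= 1.
Proof.
have /andP[f0 f1] := flat01 (m%:R * (t - a)); have /andP[g0 g1] := flat01 (m%:R * (d - t)).
by rewrite ger0_norm ?mulr_ge0// mulr_ile1.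
Qed.

Lemma cvg_bell a d t : bell m a d t @[m --> \oo] --> ((a < t < d)%R%:R : R).
Proof.
rewrite -mulnb natrM -(subr_gt0 a) -(subr_gt0 t).
by apply: cvgM; exact: cvg_flat0.
Qed.

Lemma bell_out m a d t : ~~ (a < t < d) -> bell m a d t = 0.
Proof.
rewrite negb_and -!leNgt /bell => /orP[h|h].
  by rewrite flat_le0 ?mul0r// mulr_ge0_le0// subr_le0.
by rewrite [X in _ * X]flat_le0 ?mulr0// mulr_ge0_le0// subr_le0.
Qed.

Lemma cvg_hat a d t : hat m a d t @[m --> \oo] --> (a < t < d)%R%:R * ((t - a) * (d - t)).
Proof.
rewrite [X in _ --> X](_ : _ = ((t - a) * (0 < t - a)%R%:R) * ((d - t) * (0 < d - t)%R%:R)).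
  by apply: cvgM; exact: cvg_ramp.
by rewrite !subr_gt0 -mulnb natrM; ring.
Qed.

Lemma cvg_dhat a d t : dhat m a d t @[m --> \oo] --> (a < t < d)%R%:R * (a + d - 2 * t).
Proof.
rewrite [X in _ --> X](_ : _ = (0 < t - a)%R%:R * ((d - t) * (0 < d - t)%R%:R)
   - ((t - a) * (0 < t - a)%R%:R) * (0 < d - t)%R%:R).
  by apply: cvgB; apply: cvgM; first [exact: cvg_ramp|exact: cvg_dramp].
by rewrite !subr_gt0 -mulnb natrM; ring.
Qed.

Lemma hat_out m a d t : ~~ (a < t < d) -> hat m a d t = 0.
Proof.
rewrite negb_and -!leNgt /hat /ramp => /orP[h|h].
  by rewrite flat_le0 ?mulr0 ?mul0r// mulr_ge0_le0// subr_le0.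
by rewrite [X in _ * (_ * X)]flat_le0 ?mulr0// mulr_ge0_le0// subr_le0.
Qed.

Lemma dhat_out m a d t : ~~ (a < t < d) -> dhat m a d t = 0.
Proof.
rewrite negb_and -!leNgt /dhat /ramp /dramp => /orP[h|h].
  rewrite !(flat_le0 _ (_ : m%:R * (t - a) <= 0)) ?mulr_ge0_le0 ?subr_le0//; ring.
rewrite !(flat_le0 _ (_ : m%:R * (d - t) <= 0)) ?mulr_ge0_le0 ?subr_le0//; ring.
Qed.

Lemma hat_le m a d t : a <= t <= d -> `|hat m a d t| <= (d - a) ^+ 2.
Proof.
move=> /andP[at_ td]; rewrite normrM expr2.
by apply: ler_pM => //; apply: (le_trans (ramp_le _ _)); rewrite ger0_norm; lra.
Qed.

Lemma dhat_le m a d t : a <= t <= d -> `|dhat m a d t| <= 4 * (d - a).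
Proof.
move=> /andP[at_ td].
have h1 : `|ramp m (d - t)| <= d - a by apply: (le_trans (ramp_le _ _)); rewrite ger0_norm; lra.
have h2 : `|ramp m (t - a)| <= d - a by apply: (le_trans (ramp_le _ _)); rewrite ger0_norm; lra.
rewrite (_ : 4 * (d - a) = 2 * (d - a) + (d - a) * 2); last by ring.
apply: (le_trans (ler_normB _ _)); rewrite [X in X + _]normrM [X in _ + X]normrM.
by apply: lerD; apply: ler_pM => //; exact: dramp_le.
Qed.

End bells.

(** * Products of one-variable functions as test functions *)

Section product_functions.
Context {R : realType} {n : nat}.
Implicit Types (g : 'I_n.+1 -> R -> R) (i : 'I_n.+1).

Lemma insE (v : 'rV[R]_n.+1) i : ins i (v 0 i, \row_k v 0 (lift i k)) = v.
Proof.
apply/rowP => j; have [k ->|->] := unliftP i j; last by rewrite ins_id.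
by rewrite ins_lift mxE.
Qed.

Lemma ins_shift i (h t : R) (x : 'rV[R]_n) :
  ins i (h + t, x) = h *: delta_mx 0 i + ins i (t, x).
Proof.
apply/rowP => j; rewrite !mxE eqxx /=.
case: unliftP => [k ->|->] /=; last by rewrite eqxx mulr1.
by rewrite [_ == i]eq_sym (negbTE (neq_lift _ _)) mulr0 add0r.
Qed.

(** The difference quotients themselves coincide, so both derivability and the value of the
    derivative pass between the partial derivative and the restriction to a line. *)
Lemma derive_ins_quotient (f : 'rV[R]_n.+1 -> R) i (t : R) (x : 'rV[R]_n) :
  (fun h : R => h^-1 *: (f (h *: delta_mx 0 i + ins i (t, x)) - f (ins i (t, x)))) =
  (fun h : R => h^-1 *: (f (ins i (h *: (1 : R) + t, x)) - f (ins i (t, x)))).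
Proof. by apply/funext => h; rewrite -ins_shift [h *: 1]mulr1. Qed.

Lemma derivable_ins (f : 'rV[R]_n.+1 -> R) i (t : R) (x : 'rV[R]_n) :
  derivable f (ins i (t, x)) (delta_mx 0 i) <-> derivable (fun s : R => f (ins i (s, x))) t 1.
Proof. by rewrite /derivable derive_ins_quotient. Qed.

Lemma partial_ins (f : 'rV[R]_n.+1 -> R) i (t : R) (x : 'rV[R]_n) :
  partial i f (ins i (t, x)) = (fun s : R => f (ins i (s, x)))^`()%classic t.
Proof. by rewrite derive1E /partial /derive derive_ins_quotient. Qed.

Definition prodf g (v : 'rV[R]_n.+1) : R := \prod_j g j (v 0 j).

Lemma prodf_ins g i t (x : 'rV[R]_n) :
  prodf g (ins i (t, x)) = g i t * \prod_(k < n) g (lift i k) (x 0 k).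
Proof.
by rewrite /prodf (prod_lift i) ins_id; congr (_ * _); apply: eq_bigr => k _; rewrite ins_lift.
Qed.

Definition derive_factor i g j := if j == i then (g j)^`()%classic else g j.

Lemma is_derive_prodf_ins g i t (x : 'rV[R]_n) : derivable (g i) t 1 ->
  is_derive t 1 (fun s => prodf g (ins i (s, x))) (prodf (derive_factor i g) (ins i (t, x))).
Proof.
move=> dg; under eq_fun do rewrite prodf_ins.
have h := is_deriveM (is_derive_derive1 dg)
  (is_derive_cst (\prod_(k < n) g (lift i k) (x 0 k)) t 1).
apply: (is_derive_eq h); rewrite prodf_ins /GRing.scale/= mulr0 add0r /derive_factor eqxx mulrC.
by congr (_ * _); apply: eq_bigr => k _; rewrite eq_sym (negbTE (neq_lift _ _)).
Qed.

Lemma derivable_prodf g i v : (forall j, smooth1 (g j)) ->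
  derivable (prodf g) v (delta_mx 0 i).
Proof.
move=> sg; rewrite -(insE v i); apply/derivable_ins.
by have [] := is_derive_prodf_ins (\row_k v 0 (lift i k)) (@smooth1_derivable _ _ (v 0 i) (sg i)).
Qed.

Lemma partial_prodf g i : (forall j, smooth1 (g j)) ->
  partial i (prodf g) = prodf (derive_factor i g).
Proof.
move=> sg; apply/funext => v; rewrite -(insE v i) partial_ins.
by apply: derive1_eq; apply: is_derive_prodf_ins; exact: smooth1_derivable.
Qed.

Lemma continuous_prodf g : (forall j, smooth1 (g j)) -> continuous (prodf g).
Proof.
move=> sg v; apply: cvg_big => [||j _]; [by move=> z; exact: mul_continuous|exact: nbhs_filter|].
have cj : {for v, continuous (fun w : 'rV[R]_n.+1 => w 0 j)} by exact: coord_continuous.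
have cg : {for (v 0 j), continuous (g j)} by exact: (smooth1_continuous (sg j)).
exact: (continuous_comp cj cg).
Qed.

(** A partial derivative of a product function is again one, with a single factor differentiated, so
    iterated partials never leave the class. *)
Lemma is_smooth_prodf g : (forall j, smooth1 (g j)) -> is_smooth (prodf g).
Proof.
move=> sg s.
have [g' [sg' ->]] : exists g', (forall j, smooth1 (g' j)) /\ foldr partial (prodf g) s = prodf g'.
  elim: s => [|i s [g' [sg' IH]]]; first by exists g.
  exists (derive_factor i g'); split; last by rewrite /= IH partial_prodf.
  by move=> j; rewrite /derive_factor; case: ifP => // _; exact: smooth1_derive1.
split; first exact: continuous_prodf.
by move=> i x; exact: derivable_prodf.
Qed.

End product_functions.

Section closed_boxes.
Context {R : realType} {n : nat}.
Implicit Types (a b : 'rV[R]_n).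

Definition cbox a b : set 'rV[R]_n := [set v | forall i, a 0 i <= v 0 i <= b 0 i].

Lemma compact_cbox a b : compact (cbox a b).
Proof.
have := @rV_compact R n (fun i => `[a 0 i, b 0 i]%classic) (fun i => @segment_compact _ _ _).
by congr compact; apply/seteqP; split => v /= h i; have := h i; rewrite in_itv.
Qed.

Lemma measurable_open_rV (U : set 'rV[R]_n) : open U -> measurable U.
Proof. exact: sub_sigma_algebra. Qed.

Lemma measurable_closed_rV (U : set 'rV[R]_n) : closed U -> measurable U.
Proof. by move=> cU; rewrite -(setCK U); apply: measurableC; apply: measurable_open_rV; exact: closed_openC. Qed.

Lemma closed_cbox a b : closed (cbox a b).
Proof. by apply: compact_closed; [exact: norm_hausdorff|exact: compact_cbox]. Qed.

Lemma measurable_cbox a b : measurable (cbox a b).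
Proof. by apply: measurable_closed_rV; exact: closed_cbox. Qed.

Lemma obox_cbox a b : obox a b `<=` cbox a b.
Proof. by move=> v h i; have /andP[/ltW -> /ltW ->] := h i. Qed.

Lemma continuous_measurable_rV (f : 'rV[R]_n -> R) : continuous f -> measurable_fun setT f.
Proof.
move=> cf; apply: (measurability _ (RGenOpens.measurableE R)).
move=> _ [_ [a [b ->] <-]]; rewrite setTI; apply: sub_sigma_algebra.
by apply: open_comp; [move=> v _; exact: cf|exact: interval_open].
Qed.

End closed_boxes.

Lemma test_function_prodf {R : realType} {n} (S : set 'rV[R]_n.+1) (g : 'I_n.+1 -> R -> R)
    (a b : 'rV[R]_n.+1) : (forall j, smooth1 (g j)) ->
  (forall j t, ~~ (a 0 j < t < b 0 j) -> g j t = 0) -> cbox a b `<=` S ->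
  test_function S (prodf g).
Proof.
move=> sg g0 abS; split; first exact: is_smooth_prodf.
have sub : closure [set x | prodf g x != 0] `<=` cbox a b.
  rewrite closureE; apply: smallest_sub; first exact: closed_cbox.
  move=> v /= /prodf_neq0 h; apply: obox_cbox => j; apply: contraT => /g0 gj.
  by have := h j isT; rewrite gj eqxx.
split; last exact: subset_trans sub abS.
by apply: subclosed_compact sub; [exact: closed_closure|exact: compact_cbox].
Qed.

(** * Weak derivatives along coordinate lines *)

Section integral_helpers.
Context d (T : measurableType d) (R : realType) (mu : {measure set T -> \bar R}).

Lemma Rintegral_support (D K : set T) (F : T -> R) : K `<=` D ->
  (forall x, ~ K x -> F x = 0) -> \int[mu]_(x in D) F x = \int[mu]_(x in K) F x.
Proof.
move=> KD F0; rewrite Rintegral_mkcond [RHS]Rintegral_mkcond; congr Rintegral.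
apply/funext => x; rewrite !patchE; case: (pselect (K x)) => Kx.
  by rewrite !mem_set//; exact: KD.
by rewrite (memNset Kx) F0 ?if_same.
Qed.

Lemma integrable_mul_bounded (K : set T) (f g : T -> R) (C : R) : measurable K ->
  mu.-integrable K (EFin \o f) -> measurable_fun K g -> (forall x, K x -> `|g x| <= C) ->
  mu.-integrable K (fun x => (f x * g x)%:E).
Proof.
move=> mK fi mg gC; have /integrableP[mf _] := fi.
have mf' : measurable_fun K f by apply/measurable_EFinP.
apply: (@le_integrable _ _ _ mu K mK _ (fun x => (C * f x)%:E)).
- by apply/measurable_EFinP; exact: measurable_funM.
- move=> x Kx; rewrite !abse_EFin lee_fin !normrM mulrC ler_wpM2r//.
  by rewrite (le_trans (gC x Kx))// ler_norm.
- exact: (integrableZl mK C fi).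
Qed.

End integral_helpers.

Section weak_gradient_box.
Context {R : realType} {n : nat}.
Local Notation leb := (lebesgue_rV R n.+1).
Variables (i : 'I_n.+1) (a b : 'rV[R]_n.+1).

Let box_factor (m : nat) (j : 'I_n.+1) : R -> R :=
  if j == i then hat m (a 0 j) (b 0 j) else bell m (a 0 j) (b 0 j).

Let smooth1_box_factor m j : smooth1 (box_factor m j).
Proof. by rewrite /box_factor; case: ifP => _; [exact: smooth1_hat|exact: smooth1_bell]. Qed.

Let box_factor_out m j t : ~~ (a 0 j < t < b 0 j) -> box_factor m j t = 0.
Proof. by rewrite /box_factor; case: ifP => _; [exact: hat_out|exact: bell_out]. Qed.

Let prodf_le (g : 'I_n.+1 -> R -> R) (v : 'rV[R]_n.+1) (C : R) : `|g i (v 0 i)| <= C ->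
  (forall j, j != i -> `|g j (v 0 j)| <= 1) -> `|prodf g v| <= C.
Proof.
move=> gi gj; rewrite /prodf (bigD1 i)//= normrM -[C]mulr1 ler_pM// normr_prod.
suff /andP[] : 0 <= \prod_(j | j != i) `|g j (v 0 j)| <= 1 by [].
elim/big_ind : _ => [|x y /andP[x0 x1] /andP[y0 y1]|j ji].
- by rewrite ler01 lexx.
- by rewrite mulr_ge0// mulr_ile1.
- by rewrite normr_ge0 gj.
Qed.

Let in_obox (v : 'rV[R]_n.+1) : R := (v \in obox a b)%:R.

Let in_oboxE v : in_obox v = \prod_j (a 0 j < v 0 j < b 0 j)%R%:R.
Proof.
rewrite /in_obox; case: (pselect (obox a b v)) => h.
  by rewrite mem_set// big1// => j _; rewrite h.
rewrite memNset//; apply/esym; move/existsNP: h => [j /negP/negbTE h].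
by rewrite (bigD1 j)//= h mul0r.
Qed.

Let cvg_prodf (g : nat -> 'I_n.+1 -> R -> R) (v : 'rV[R]_n.+1) (X : R) :
  g m i (v 0 i) @[m --> \oo] --> (a 0 i < v 0 i < b 0 i)%R%:R * X ->
  (forall j, j != i -> g m j (v 0 j) @[m --> \oo] --> ((a 0 j < v 0 j < b 0 j)%R%:R : R)) ->
  prodf (g m) v @[m --> \oo] --> in_obox v * X.
Proof.
move=> gi gj; rewrite in_oboxE (bigD1 i)//= mulrAC /prodf.
under eq_cvg do rewrite (bigD1 i)//=.
apply: cvgM; first exact: gi.
by apply: cvg_big => [|j ji]; [by move=> z; exact: mul_continuous|exact: gj].
Qed.

(** This is the weak identity for the non-smooth test function equal to (t - a)(d - t) in direction
    i, times the indicator of the box. It is the limit of the identities for [phi m], which uses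
    [hat] in direction i and [bell] in the others. *)
Lemma weak_gradient_obox (S : set 'rV[R]_n.+1) f G : measurable S ->
  weak_gradient S f G -> cbox a b `<=` S ->
  (\int[leb]_(v in obox a b) (f v * (a 0 i + b 0 i - 2 * v 0 i) +
     G v 0 i * ((v 0 i - a 0 i) * (b 0 i - v 0 i)))%:E = 0)%E.
Proof.
move=> mS [[mf fl] Gl wg] abS; have [mG Gil] := Gl i.
pose K := cbox a b.
have mK : measurable K by exact: measurable_cbox.
have fK : leb.-integrable K (EFin \o f) by apply: fl => //; exact: compact_cbox.
have GK : leb.-integrable K (EFin \o (fun x => G x 0 i)) by apply: Gil => //; exact: compact_cbox.
pose phi m := prodf (box_factor m).
pose dphi m := prodf (derive_factor i (box_factor m)).
have dphiE m : partial i (phi m) = dphi m by rewrite partial_prodf.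
have dfactor m j : derive_factor i (box_factor m) j =
    if j == i then dhat m (a 0 j) (b 0 j) else bell m (a 0 j) (b 0 j).
  by rewrite /derive_factor /box_factor; case: (j == i) => //; rewrite derive1_hat.
have mphi m : measurable_fun K (phi m).
  by apply: measurable_funTS; apply: continuous_measurable_rV; exact: continuous_prodf.
have mdphi m : measurable_fun K (dphi m).
  apply: measurable_funTS; apply: continuous_measurable_rV; apply: continuous_prodf => j.
  by rewrite /derive_factor; case: ifP => // _; exact: smooth1_derive1.
(* The bounds of [hat_le] and [dhat_le]; the remaining factors are at most 1. If the i-th side is
   reversed, C' is negative but K is empty. *)
pose C := (b 0 i - a 0 i) ^+ 2; pose C' := 4 * (b 0 i - a 0 i).
have phiC m v : K v -> `|phi m v| <= C.
  move=> Kv; apply: prodf_le => [|j ji]; rewrite /box_factor ?eqxx ?(negbTE ji).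
    by apply: hat_le; exact: Kv.
  exact: bell_le.
have dphiC m v : K v -> `|dphi m v| <= C'.
  move=> Kv; apply: prodf_le => [|j ji]; rewrite dfactor ?eqxx ?(negbTE ji).
    by apply: dhat_le; exact: Kv.
  exact: bell_le.
have out0 m v : ~ K v -> phi m v = 0 /\ dphi m v = 0.
  move=> Kv; have : ~ obox a b v by apply: contra_not Kv; exact: obox_cbox.
  move=> /existsNP[j /negP h]; split; rewrite /phi /dphi /prodf (bigD1 j)//=.
    by rewrite box_factor_out ?mul0r.
  by rewrite dfactor; case: ifP => _; rewrite ?dhat_out ?bell_out ?mul0r.
have i1 m : leb.-integrable K (fun v => (f v * dphi m v)%:E).
  exact: (integrable_mul_bounded mK fK (mdphi m) (dphiC m)).
have i2 m : leb.-integrable K (fun v => (G v 0 i * phi m v)%:E).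
  exact: (integrable_mul_bounded mK GK (mphi m) (phiC m)).
pose h m v := f v * dphi m v + G v 0 i * phi m v.
have ih m : leb.-integrable K (EFin \o h m).
  exact: (integrableD mK (i1 m) (i2 m)).
have h0 m : (\int[leb]_(v in K) (h m v)%:E = 0)%E.
  have tf : test_function S (phi m).
    by apply: (test_function_prodf (a := a) (b := b)) => // j t; exact: box_factor_out.
  have := wg _ tf i; rewrite dphiE (@Rintegral_support _ _ _ _ S K)//; last first.
    by move=> v /(out0 m)[_ ->]; rewrite mulr0.
  rewrite [X in _ = - X](@Rintegral_support _ _ _ _ S K)//; last first.
    by move=> v /(out0 m)[-> _]; rewrite mulr0.
  move/eqP; rewrite -addr_eq0 -(RintegralD mK (i1 m) (i2 m)) => /eqP.
  rewrite /Rintegral => h0; rewrite -[LHS]fineK ?integrable_fin_num//; last exact: ih.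
  by congr EFin; rewrite -[RHS]h0.
pose l v := in_obox v * (f v * (a 0 i + b 0 i - 2 * v 0 i) +
     G v 0 i * ((v 0 i - a 0 i) * (b 0 i - v 0 i))).
have hl v : h m v @[m --> \oo] --> l v.
  rewrite /l mulrDr [_ * (f v * _)]mulrCA [_ * (G v 0 i * _)]mulrCA; apply: cvgD; apply: cvgMr.
    apply: (cvg_prodf (g := fun m => derive_factor i (box_factor m))) => [|j ji].
      by under eq_cvg do rewrite dfactor eqxx; exact: cvg_dhat.
    by under eq_cvg do rewrite dfactor (negbTE ji); exact: cvg_bell.
  apply: (cvg_prodf (g := box_factor)) => [|j ji].
    by under eq_cvg do rewrite /box_factor eqxx; exact: cvg_hat.
  by under eq_cvg do rewrite /box_factor (negbTE ji); exact: cvg_bell.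
have mh m : measurable_fun K (EFin \o h m) by exact: measurable_int (ih m).
have hlE v : K v -> (h ^~ v m)%:E @[m --> \oo] --> (l v)%:E.
  by move=> _; apply: cvg_EFin; [exact: nearW|exact: hl].
have gK : leb.-integrable K (fun v => (C' * `|f v| + C * `|G v 0 i|)%:E).
  exact: (integrableD mK (integrableZl mK C' (integrable_abse fK))
    (integrableZl mK C (integrable_abse GK))).
have hg m v : K v -> (`|(h m v)%:E| <= (C' * `|f v| + C * `|G v 0 i|)%:E)%E.
  move=> Kv; rewrite lee_fin /h (le_trans (ler_normD _ _))// !normrM.
  by apply: lerD; rewrite mulrC ler_wpM2r// ?dphiC ?phiC.
have gfin v : K v -> (C' * `|f v| + C * `|G v 0 i|)%:E \is a fin_num by [].
have cv := dominated_cvg mK mh hlE gfin gK hg.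
have : (\int[leb]_(v in K) (l v)%:E = 0)%E.
  have cv0 : (\int[leb]_(v in K) (h m v)%:E)%E @[m --> \oo] --> (0 : \bar R)%E.
    rewrite (_ : (fun m => _) = cst 0%E); last by apply/funext => m; exact: h0.
    exact: cvg_cst.
  exact: (cvg_unique (@ereal_hausdorff R) cv cv0).
rewrite [in X in X -> _]integral_mkcond [in X in _ -> X]integral_mkcond => <-.
apply: eq_integral => v _; rewrite !patchE /l /in_obox.
case: (pselect (obox a b v)) => ov.
  by rewrite !mem_set ?mul1r//; exact: obox_cbox.
by rewrite (memNset ov) mul0r if_same.
Qed.

End weak_gradient_box.

(** * One-dimensional weak derivatives *)

Section weak_derivative_1d.
Context {R : realType}.
Local Notation mu := (@lebesgue_measure R).
Variables (a b : R) (v g : R -> R).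
Hypotheses (ab : a < b) (iv : mu.-integrable `[a, b] (EFin \o v))
  (ig : mu.-integrable `[a, b] (EFin \o g)).
Hypothesis vg : forall q : rat, a < ratr q < b ->
  (\int[mu]_(t in `]a, (ratr q : R)[) (v t * (a + ratr q - 2 * t) +
    g t * ((t - a) * (ratr q - t)))%:E = 0)%E.

Let I := `[a, b]%classic : set (measurableTypeR R).
(** With this [w] and the next function [y], the integrand of the hypothesis with right end d
    becomes [d * w t - y t], in which d is separated from t. *)
Let w t := v t + g t * (t - a).
Let y t := v t * (t - a) + w t * t.

Let mI : measurable I. Proof. exact: measurable_itv. Qed.

Let iM f (c : R) : mu.-integrable I (EFin \o f) -> mu.-integrable I (fun t => (f t * (t - c))%:E).
Proof.
move=> fi; apply: (@integrable_mul_bounded _ _ _ _ _ f (fun t => t - c) (`|a| + `|b| + `|c|)) => //.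
  exact: measurable_funB.
move=> t; rewrite /I /= in_itv/= => /andP[at_ tb].
apply: (le_trans (ler_normB _ _)); rewrite lerD2r.
rewrite ler_norml; have := ler_norm b; have := ler_norm (- a); rewrite normrN => ? ?.
have := normr_ge0 a; have := normr_ge0 b => ? ?; apply/andP; split; lra.
Qed.

Let iw : mu.-integrable I (EFin \o w).
Proof. exact: (integrableD mI iv (iM a ig)). Qed.

Let iy : mu.-integrable I (EFin \o y).
Proof.
have h := iM 0 iw; apply: (eq_integrable mI _ _ _ (integrableD mI (iM a iv) h)) => t _ /=.
by rewrite subr0.
Qed.

(** The cut-off outside [I] makes the integrand integrable on the whole line, as the fundamental
    theorem of calculus is applied there; for x <= b the value is unaffected. *)
Let primitive f x := \int[mu]_(t in `[a, x]) (f \_ I) t.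

Let primitiveE f x : x <= b -> primitive f x = \int[mu]_(t in `[a, x]) f t.
Proof.
move=> xb; apply: eq_Rintegral => t /[!inE] /=; rewrite in_itv/= => /andP[at_ tx].
by rewrite patchE mem_set// /I /= in_itv/= at_ (le_trans tx).
Qed.

Let integrable_restr f : mu.-integrable I (EFin \o f) -> mu.-integrable setT (EFin \o (f \_ I)).
Proof. by move=> fi; rewrite -restrict_EFin; exact: (integrable_mkcond _ mI).1. Qed.

Let FTC_primitive f : mu.-integrable I (EFin \o f) ->
  {ae mu, forall x, a < x < b -> is_derive x 1 (primitive f) (f x)}.
Proof.
move=> fi; have fT := integrable_restr fi.
have fz z : mu.-integrable `[a, z] (EFin \o (f \_ I)) by exact: integrableS fT.
have := @FTC1 R (f \_ I) (BLeft a) fz (open_integrable_locally openT fT).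
apply: filterS; first exact: (ae_filter_ringOfSetsType mu).
move=> x /= h /andP[ax xb].
have [dF F'] := h ax; apply: DeriveDef; first exact: dF.
rewrite -derive1E [LHS]F' patchE mem_set//.
by rewrite /I /= in_itv/= !ltW.
Qed.

Let continuous_primitive f x : mu.-integrable I (EFin \o f) -> a < x < b ->
  {for x, continuous (primitive f)}.
Proof.
move=> fi xab; have fT := integrable_restr fi.
have fab : mu.-integrable `[a, b] (EFin \o (f \_ I)) by exact: integrableS fT.
have := parameterized_integral_continuous (ltW ab) fab.
move=> /continuous_within_itvP -/(_ ab)[h _ _].
by apply: h; rewrite in_itv.
Qed.

Let primitive_rat (q : rat) : a < ratr q < b -> ratr q * primitive w (ratr q) = primitive y (ratr q).
Proof.
set d : R := ratr q => /andP[ad db]; have := @vg q; rewrite -/d ad db => /(_ isT) h.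
rewrite !primitiveE ?ltW//.
have sub : `[a, d] `<=` I.
  by move=> t; rewrite /I /= !in_itv/= => /andP[-> td]; rewrite (le_trans td)// ltW.
have md : measurable (`[a, d]%classic : set (measurableTypeR R)) by exact: measurable_itv.
have iS f : mu.-integrable I (EFin \o f) -> mu.-integrable `[a, d] (EFin \o f).
  exact: integrableS.
rewrite -(RintegralZl _ md (iS _ iw)).
apply/eqP; rewrite -subr_eq0 -(RintegralB md (integrableZl md d (iS _ iw)) (iS _ iy)).
apply/eqP; rewrite /Rintegral.
have -> : (\int[mu]_(t in `[a, d]) (d * w t - y t)%:E = \int[mu]_(t in `]a, d[) (v t * (a + d - 2 * t) +
    g t * ((t - a) * (d - t)))%:E)%E.
  have mz : measurable_fun (`[a, d]%classic : set (measurableTypeR R)) (fun t => (d * w t - y t)%:E).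
    exact: (measurable_int _ (integrableB md (integrableZl md d (iS _ iw)) (iS _ iy))).
  rewrite -integral_itv_bndo_bndc; last first.
    apply: measurable_funS mz => // t /=; rewrite !in_itv/= => /andP[-> td].
    exact: ltW.
  rewrite -integral_itv_obnd_cbnd; last first.
    apply: measurable_funS mz => // t /=; rewrite !in_itv/= => /andP[at_ td].
    by rewrite !ltW.
  by apply: eq_integral => t _; congr EFin; rewrite /y /w; ring.
by rewrite h.
Qed.

(** Both sides are continuous in x and agree at rational points, which are dense. *)
Let primitive_eq x : a < x < b -> x * primitive w x = primitive y x.
Proof.
move=> xab; pose h (z : R) := z * primitive w z - primitive y z.
suff : h x = 0 by move/eqP; rewrite subr_eq0 => /eqP.
have ch : {for x, continuous h}.
  apply: cvgB; last exact: (continuous_primitive iy xab).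
  by apply: cvgM; [exact: cvg_id|exact: (continuous_primitive iw xab)].
apply/eqP; apply: contraT => hx.
have : \forall z \near x, h z != 0 /\ a < z < b.
  have /andP[ax xb] := xab; near=> z; split; last first.
    apply/andP; split; near: z; [exact: lt_nbhsr|exact: lt_nbhsl].
  near: z; apply: (cvgr_neq0 (h x)) => //; exact: ch.
move=> /nbhs_ballP[e /= e0 he].
have : ball x e `&` range (@ratr R) !=set0.
  by apply: dense_rat; [exists x; exact: ballxx|exact: ball_open].
move=> [_ [/[swap] -[q _ <-] /he [+ qab]]].
by rewrite /h primitive_rat// subrr eqxx.
Unshelve. all: by end_near. Qed.

(* For d in ]a, b[ the hypothesis reads d * int_a^d w = int_a^d y; differentiating
   in d gives (d - a) * v d = int_a^d w a.e., and w = v + (t - a) g. *)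
Lemma weak_derivative_1d : exists V : R -> R,
  {ae mu, forall t, a < t < b -> v t = V t /\ is_derive t 1 V (g t)}.
Proof.
exists (fun x => primitive w x * (x - a)^-1).
have := FTC_primitive iw; have := FTC_primitive iy; apply: filterS2; first exact: (ae_filter_ringOfSetsType mu).
move=> t dy dw tab.
have {}dy := dy tab; have {}dw := dw tab; have [/andP[at_ tb]] := (tab, tab).
have ta0 : t - a != 0 by rewrite subr_eq0 gt_eqF.
have vE : v t * (t - a) = primitive w t.
  have d1 : is_derive t 1 (fun x => x * primitive w x) (t * w t + primitive w t).
    apply: (is_derive_eq (is_deriveM (is_derive_id t (1 : R)) dw)).
    by rewrite /GRing.scale/= mulr1.
  (* The same function has derivative [t * w t + primitive w t] by the product rule; comparing with
     [y t] cancels [t * w t] and leaves [vE]. *)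
  have : is_derive t 1 (fun x => x * primitive w x) (y t).
    apply: near_eq_is_derive dy; near=> z; apply/esym/primitive_eq.
    apply/andP; split; near: z; [exact: lt_nbhsr|exact: lt_nbhsl].
  move=> /derive1_eq; rewrite (derive1_eq d1) /y [t * _]mulrC => /eqP.
  by rewrite addrC -subr_eq addrK => /eqP.
split; first by rewrite -vE mulfK.
have dV : is_derive t 1 (fun x : R => (x - a)^-1) (- (t - a) ^- 2).
  have h : is_derive t 1 (fun x : R => x - a) 1.
    by apply: (is_derive_eq (is_deriveB (is_derive_id t (1 : R)) (is_derive_cst a t 1))); rewrite subr0.
  by apply: (is_derive_eq (@is_deriveV R (fun x : R => x - a) t 1 1 ta0 h)); rewrite /GRing.scale/= mulr1.
apply: (is_derive_eq (is_deriveM dw dV)); rewrite /GRing.scale/= -vE /w.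
by field.
Unshelve. all: by end_near. Qed.

End weak_derivative_1d.

(** For s and t off the null set, the product of the difference quotients of [V1] and [V2] is the
    assumed nonnegative product divided by (s - t)^2. A negative limit [g1 t * g2 t] would make it
    negative for all s close to t, including some s off the null set. *)
Lemma monotone_derivatives_ge0 {R : realType} (a b : R) (v1 g1 v2 g2 V1 V2 : R -> R) :
  (forall s t, a < s < b -> a < t < b -> 0 <= (v1 s - v1 t) * (v2 s - v2 t)) ->
  {ae @lebesgue_measure R, forall t, a < t < b -> v1 t = V1 t /\ is_derive t 1 V1 (g1 t)} ->
  {ae @lebesgue_measure R, forall t, a < t < b -> v2 t = V2 t /\ is_derive t 1 V2 (g2 t)} ->
  {ae @lebesgue_measure R, forall t, a < t < b -> 0 <= g1 t * g2 t}.
Proof.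
move=> mono ae1 ae2.
have : {ae @lebesgue_measure R, forall t, a < t < b ->
    [/\ v1 t = V1 t, is_derive t 1 V1 (g1 t), v2 t = V2 t & is_derive t 1 V2 (g2 t)]}.
  move: ae1 ae2; apply: filterS2; first exact: (ae_filter_ringOfSetsType (@lebesgue_measure R)).
  by move=> t h1 h2 tab; have [? ?] := h1 tab; have [? ?] := h2 tab.
move=> [N [mN N0 subN]].
have E t : ~ N t -> a < t < b ->
    [/\ v1 t = V1 t, is_derive t 1 V1 (g1 t), v2 t = V2 t & is_derive t 1 V2 (g2 t)].
  by move=> Nt; apply: contrapT => h; apply: Nt; exact: subN.
exists N; split => // t /= /not_implyP[tab /negP]; rewrite -ltNge => g0.
apply: contrapT => Nt; have [v1t d1 v2t d2] := E t Nt tab.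
pose Q (h : R) := (h^-1 *: (V1 (h *: 1 + t) - V1 t)) * (h^-1 *: (V2 (h *: 1 + t) - V2 t)).
have cQ : Q @ 0^' --> g1 t * g2 t.
  by apply: cvgM; [case: d1 => + <-|case: d2 => + <-] => /cvg_ex[l hl];
    rewrite /derive (cvg_lim _ hl).
have : \forall h \near 0^', Q h < 0 by apply: cvgr_lt cQ _ g0.
rewrite near_withinE => /nbhs_ballP[r /= r0 hr].
move/andP: (tab) => [at_ tb].
pose r' := Num.min r (b - t).
have r'0 : 0 < r' by rewrite lt_min r0 subr_gt0.
(* An interval of positive length cannot be contained in the null set [N]. The bound r' <= b - t
   keeps s below b. *)
have [s [ts sr Ns]] : exists s, [/\ t < s, s < t + r' & ~ N s].
  apply: contrapT => hs.
  have sub : `]t, t + r'[ `<=` N.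
    move=> s /=; rewrite in_itv/= => /andP[ts sr]; apply: contrapT => Ns.
    by apply: hs; exists s.
  have : (lebesgue_measure (`]t, (t + r')%R[ : set R) <= lebesgue_measure N)%E.
    by apply: le_measure; rewrite ?inE//; exact: measurable_itv.
  rewrite /= lebesgue_measure_itv/= lte_fin ltrDl r'0 -EFinB.
  by rewrite [X in (_ <= X)%E]N0 lee_fin addrC addKr leNgt r'0.
have srt : s < t + r /\ s < b by move: sr; rewrite -ltrBlDl lt_min => /andP[? ?]; split; lra.
have sab : a < s < b by rewrite (lt_trans at_ ts); case: srt.
have [v1s _ v2s _] := E s Ns sab.
have h0 : s - t != 0 by rewrite subr_eq0 gt_eqF.
have := hr (s - t); rewrite /ball/= sub0r normrN gtr0_norm ?subr_gt0// => /(_ _ h0).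
have [sr' _] := srt; rewrite ltrBlDl => /(_ sr').
rewrite /Q [(s - t) *: 1]mulr1 subrK /GRing.scale/= -v1s -v1t -v2s -v2t mulrACA.
rewrite pmulr_rlt0; last by rewrite -expr2 exprn_even_gt0//= invr_neq0.
by rewrite ltNge mono.
Qed.

Lemma ae_forall_countable d (T : measurableType d) (R : realType)
    (mu : {measure set T -> \bar R}) (I : countType) (P : I -> T -> Prop) :
  (forall i, {ae mu, forall x, P i x}) -> {ae mu, forall x, forall i, P i x}.
Proof.
move=> aeP; have : {ae mu, forall x, forall m, if unpickle m is Some i then P i x else True}.
  by apply: ae_foralln => m; case: unpickle => [i|]; [exact: aeP|exact: aeW].
by apply: filterS => x h i; have := h (pickle i); rewrite pickleK.
Qed.

(** * From weak gradients to almost every coordinate line *)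

Section slices.
Context {R : realType} {n : nat}.
Local Notation leb1 := (@lebesgue_measure R).
Local Notation lebn := (lebesgue_rV R n).
Local Notation leb := (lebesgue_rV R n.+1).
Variables (S : set 'rV[R]_n.+1) (mS : measurable S) (i : 'I_n.+1).

Definition deli (v : 'rV[R]_n.+1) : 'rV[R]_n := \row_k v 0 (lift i k).

Lemma deli_ins z : deli (ins i z) = z.2.
Proof. by apply/rowP => k; rewrite mxE ins_lift. Qed.

Lemma obox_ins (a b : 'rV[R]_n.+1) t x :
  obox a b (ins i (t, x)) <-> a 0 i < t < b 0 i /\ obox (deli a) (deli b) x.
Proof.
have := preimage_ins_obox i a b; move/seteqP => [h1 h2]; split.
  by move=> /(h1 (t, x)) [] /=; rewrite in_itv.
by move=> [tab xab]; apply: (h2 (t, x)); split => //=; rewrite in_itv.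
Qed.

Section slice_of_gradient.
Variables (f : 'rV[R]_n.+1 -> R) (G : 'rV[R]_n.+1 -> 'rV[R]_n.+1).
Hypothesis wg : weak_gradient S f G.

Let H (a b v : 'rV[R]_n.+1) : R := f v * (a 0 i + b 0 i - 2 * v 0 i) +
     G v 0 i * ((v 0 i - a 0 i) * (b 0 i - v 0 i)).

Let integrable_f a b : cbox a b `<=` S -> leb.-integrable (cbox a b) (EFin \o f).
Proof. by case: wg => -[_ fl] _ _ abS; apply: fl => //; exact: compact_cbox. Qed.

Let integrable_G a b : cbox a b `<=` S -> leb.-integrable (cbox a b) (EFin \o (fun v => G v 0 i)).
Proof. by case: wg => _ /(_ i)[_ Gl] _ abS; apply: Gl => //; exact: compact_cbox. Qed.

Let integrable_H a b : cbox a b `<=` S -> leb.-integrable setT (EFin \o (H a b \_ (obox a b))).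
Proof.
move=> abS; rewrite -restrict_EFin; apply: (integrable_mkcond _ (measurable_obox _ _)).1.
have mK := measurable_cbox a b.
have mi : measurable_fun (cbox a b) (fun v : 'rV[R]_n.+1 => v 0 i).
  by apply: measurable_funTS; exact: measurable_coord.
suff : leb.-integrable (cbox a b) (EFin \o H a b).
  by apply: integrableS => //; [exact: measurable_obox|exact: obox_cbox].
have i1 : leb.-integrable (cbox a b) (fun v => (f v * (a 0 i + b 0 i - 2 * v 0 i))%:E).
  apply: (integrable_mul_bounded (C := b 0 i - a 0 i)) => //; first exact: integrable_f.
    by apply: measurable_funB => //; exact: measurable_funM.
  by move=> v /(_ i)/andP[? ?]; rewrite ler_norml; apply/andP; split; lra.
have i2 : leb.-integrable (cbox a b)
    (fun v => (G v 0 i * ((v 0 i - a 0 i) * (b 0 i - v 0 i)))%:E).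
  apply: (integrable_mul_bounded (C := (b 0 i - a 0 i) * (b 0 i - a 0 i))) => //.
  - exact: integrable_G.
  - by apply: measurable_funM; exact: measurable_funB.
  - by move=> v /(_ i)/andP[? ?]; rewrite normrM ler_pM// ger0_norm; lra.
exact: (integrableD mK i1 i2).
Qed.

(** The line integral is an integrable function of x. Its integral over any box of x is, by Fubini,
    the identity of [weak_gradient_obox] on a smaller box, so it is 0 and [ae_eq0_obox] applies. *)
Let slice_integral_eq0 a b : cbox a b `<=` S ->
  {ae lebn, forall x, (\int[leb1]_t ((H a b \_ (obox a b)) (ins i (t, x)))%:E = 0)%E}.
Proof.
move=> abS; have iH := integrable_H abS.
have iG := integrable_slice_integral i iH.
apply: (ae_eq0_obox iG) => c e.
(* The smaller box is cut by [obox c e] in the transversal directions only. It keeps the i-th ends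
   of a and b, so the weight in [H] is unchanged. *)
pose a1 : 'rV[R]_n := \row_(k < n) Num.max (deli a 0 k) (c 0 k).
pose b1 : 'rV[R]_n := \row_(k < n) Num.min (deli b 0 k) (e 0 k).
pose a' := ins i (a 0 i, a1); pose b' := ins i (b 0 i, b1).
have sub : cbox a' b' `<=` cbox a b.
  move=> v h j; have := h j; rewrite /a' /b'.
  have [k ->|->] := unliftP i j; last by rewrite !ins_id.
  by rewrite !ins_lift /= !mxE ge_max le_min => /andP[/andP[-> _] /andP[-> _]].
have abS' : cbox a' b' `<=` S by exact: subset_trans sub abS.
have oE t x : obox a' b' (ins i (t, x)) <-> obox a b (ins i (t, x)) /\ obox c e x.
  rewrite !obox_ins /a' /b' !ins_id !deli_ins /=; split.
    move=> [-> h]; split; [split => // k|move=> k]; have := h k;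
      rewrite !mxE gt_max lt_min => /andP[/andP[h1 h2] /andP[h3 h4]];
      by apply/andP.
  move=> [[-> h] h']; split => // k; have := h k; have /andP[h3 h4] := h' k.
  by rewrite !mxE gt_max lt_min h3 h4 !andbT.
have HE : H a' b' = H a b by apply/funext => v; rewrite /H /a' /b' !ins_id.
rewrite integral_mkcond.
transitivity (\int[lebn]_x \int[leb1]_t ((H a' b' \_ (obox a' b')) (ins i (t, x)))%:E)%E.
  apply: eq_integral => x _; rewrite patchE; case: (pselect (obox c e x)) => cx.
    rewrite mem_set//; apply: eq_integral => t _; congr EFin.
    rewrite !patchE HE; case: (pselect (obox a b (ins i (t, x)))) => h.
      by rewrite !mem_set//; apply/oE.
    by rewrite !memNset// => /oE[].
  rewrite memNset//; apply/esym; apply: integral0_eq => t _.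
  by rewrite patchE memNset// => /oE[].
rewrite (@integral_ins _ _ i (EFin \o (H a' b' \_ (obox a' b')))); last exact: integrable_H.
have := weak_gradient_obox i mS wg abS'; rewrite integral_mkcond => h0.
rewrite -[RHS]h0; apply: eq_integral => v _; rewrite /= !patchE /H.
by case: ifP.
Qed.

(** The null set of lines in [slice_integral_eq0] depends on the box. Letting the upper i-th end run
    through the rationals keeps the union of these sets null, and [weak_derivative_1d] asks for no
    other right ends. *)
Lemma ae_slice (a b : 'rV[R]_n.+1) : a 0 i < b 0 i -> cbox a b `<=` S ->
  {ae lebn, forall x, obox (deli a) (deli b) x -> exists V : R -> R,
    {ae leb1, forall t, a 0 i < t < b 0 i ->
      f (ins i (t, x)) = V t /\ is_derive t 1 V (G (ins i (t, x)) 0 i)}}.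
Proof.
move=> ab abS; have mK := measurable_cbox a b.
have int_slice (h : 'rV[R]_n.+1 -> R) : leb.-integrable (cbox a b) (EFin \o h) ->
    {ae lebn, forall x, obox (deli a) (deli b) x ->
      leb1.-integrable `[a 0 i, b 0 i] (EFin \o (fun t => h (ins i (t, x))))}.
  move=> ih; have iT : leb.-integrable setT (EFin \o (h \_ (cbox a b))).
    by rewrite -restrict_EFin; exact: (integrable_mkcond _ mK).1.
  have := ae_integrable2 (integrable_ins i iT); apply: filterS => x hx xab.
  have : leb1.-integrable `[a 0 i, b 0 i]
      (fun t => (EFin \o (h \_ (cbox a b)) \o ins i) (t, x)) by exact: integrableS hx.
  apply: eq_integrable => // t; rewrite inE/= in_itv/= => tab.
  rewrite /= patchE mem_set//= => j; have [k ->|->] := unliftP i j; last by rewrite ins_id.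
  by rewrite ins_lift; have := xab k; rewrite !mxE => /andP[/ltW -> /ltW ->].
have aeq : {ae lebn, forall x, forall q : rat,
    a 0 i < ratr q < b 0 i -> obox (deli a) (deli b) x ->
    (\int[leb1]_(t in `](a 0 i)%R, (ratr q : R)[) (f (ins i (t, x)) * (a 0 i + ratr q - 2 * t) +
      G (ins i (t, x)) 0 i * ((t - a 0 i) * (ratr q - t)))%:E = 0)%E}.
  apply: ae_forall_countable => q.
  have [qab|nq] := boolP (a 0 i < ratr q < b 0 i); last first.
    exact: aeW.
  pose b' := ins i (ratr q : R, deli b).
  have sub : cbox a b' `<=` cbox a b.
    move=> v h j; have := h j; rewrite /b'.
    have [k ->|->] := unliftP i j; first by rewrite (ins_lift _ _ k) mxE.
    by rewrite ins_id => /andP[-> vq]; rewrite (le_trans vq)// ltW//; case/andP: qab.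
  have := slice_integral_eq0 (subset_trans sub abS); apply: filterS => x h0 _ xab.
  rewrite -[RHS]h0 integral_mkcond; apply: eq_integral => t _.
  rewrite !patchE /H ins_id /b' ins_id.
  have oE : obox a b' (ins i (t, x)) <-> a 0 i < t < ratr q.
    by rewrite obox_ins ins_id deli_ins /=; split => [[]//|->].
  have [tq|tq] := boolP (a 0 i < t < ratr q).
    by rewrite !mem_set//= ?in_itv//; apply/oE.
  by rewrite !memNset//= ?in_itv/=; [move/oE|]; apply/negP.
have := aeq; have := int_slice _ (integrable_G abS); have := int_slice _ (integrable_f abS).
apply: filterS3 => x ifx iGx hx xab.
apply: weak_derivative_1d ab (ifx xab) (iGx xab) _ => q qab.
exact: hx qab xab.
Qed.

End slice_of_gradient.

Lemma gradient_sign_box (f1 f2 : 'rV[R]_n.+1 -> R) (G1 G2 : 'rV[R]_n.+1 -> 'rV[R]_n.+1)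
    (a b : 'rV[R]_n.+1) :
  weak_gradient S f1 G1 -> weak_gradient S f2 G2 ->
  (forall v w, S v -> S w -> 0 <= (f1 v - f1 w) * (f2 v - f2 w)) ->
  a 0 i < b 0 i -> cbox a b `<=` S ->
  {ae leb, forall v, obox a b v -> 0 <= G1 v 0 i * G2 v 0 i}.
Proof.
move=> wg1 wg2 mono ab abS.
pose P := [set v | obox a b v -> 0 <= G1 v 0 i * G2 v 0 i].
have mO := measurable_obox a b.
have oS : obox a b `<=` S by exact: subset_trans (@obox_cbox _ _ _ _) abS.
(* Needed for [ae_ins]. The gradients are measurable on S only, so P is split into the complement of
   the box, where its condition is void, and a part inside the box. *)
have mP : measurable P.
  have mGG : measurable_fun (obox a b) (fun v => G1 v 0 i * G2 v 0 i).
    case: wg1 => _ /(_ i)[m1 _] _; case: wg2 => _ /(_ i)[m2 _] _.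
    by apply: measurable_funM; [exact: measurable_funS m1|exact: measurable_funS m2].
  have -> : P = ~` (obox a b) `|` (obox a b `&` (fun v => G1 v 0 i * G2 v 0 i) @^-1` `[0, +oo[).
    apply/seteqP; split => v /=.
      have [ov h|nov _] := pselect (obox a b v); last by left.
      by right; rewrite in_itv/= andbT; split => //; exact: h.
    by move=> [nov ov|[_ h] _]; [have := nov ov|move: h; rewrite in_itv/= andbT].
  by apply: measurableU; [exact: measurableC|exact: mGG].
apply: (ae_ins (i := i) mP).
have := ae_slice wg2 ab abS; have := ae_slice wg1 ab abS.
apply: filterS2 => x h1 h2.
have [xab|nx] := pselect (obox (deli a) (deli b) x); last first.
  by apply: aeW => t; rewrite /P /= => /obox_ins[].
have [V1 ae1] := h1 xab; have [V2 ae2] := h2 xab.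
have := @monotone_derivatives_ge0 R _ _ _ _ _ _ _ _ _ ae1 ae2.
have mono' s t : a 0 i < s < b 0 i -> a 0 i < t < b 0 i ->
    0 <= (f1 (ins i (s, x)) - f1 (ins i (t, x))) * (f2 (ins i (s, x)) - f2 (ins i (t, x))).
  by move=> sab tab; apply: mono; apply: oS; apply/obox_ins.
move=> /(_ mono'); apply: filterS; first exact: (ae_filter_ringOfSetsType leb1).
by move=> t ht /obox_ins[tab _]; exact: ht.
Qed.

End slices.

(** An open set is covered by countably many rational boxes whose closures it contains, so
    [gradient_sign_box] for all boxes and all coordinates still costs only one null set. *)
Lemma gradient_sign {R : realType} n (S : set 'rV[R]_n.+1) (f1 f2 : 'rV[R]_n.+1 -> R) G1 G2 :
  open S -> weak_gradient S f1 G1 -> weak_gradient S f2 G2 ->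
  (forall v w, S v -> S w -> 0 <= (f1 v - f1 w) * (f2 v - f2 w)) ->
  {ae lebesgue_rV R n.+1, forall v, S v -> forall i, 0 <= G1 v 0 i * G2 v 0 i}.
Proof.
move=> oS wg1 wg2 mono; have mS := measurable_open_rV oS.
pose e (k : nat) : R := k.+1%:R^-1.
pose lo (qk : 'rV[rat]_n.+1 * nat) : 'rV[R]_n.+1 := \row_(j < n.+1) (ratr (qk.1 0 j) - e qk.2).
pose hi (qk : 'rV[rat]_n.+1 * nat) : 'rV[R]_n.+1 := \row_(j < n.+1) (ratr (qk.1 0 j) + e qk.2).
have e0 k : 0 < e k by rewrite invr_gt0.
have : {ae lebesgue_rV R n.+1, forall v, forall qki : 'rV[rat]_n.+1 * nat * 'I_n.+1,
    cbox (lo qki.1) (hi qki.1) `<=` S -> obox (lo qki.1) (hi qki.1) v ->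
    0 <= G1 v 0 qki.2 * G2 v 0 qki.2}.
  apply: ae_forall_countable => -[qk i] /=.
  have [sub|nsub] := pselect (cbox (lo qk) (hi qk) `<=` S); last by apply: aeW => v /nsub.
  have := gradient_sign_box mS (i := i) wg1 wg2 mono _ sub.
  have -> : lo qk 0 i < hi qk 0 i by rewrite !mxE; have := e0 qk.2; lra.
  by move=> /(_ isT); apply: filterS => v h _; exact: h.
apply: filterS => v hv Sv i.
have /nbhs_ballP[r /= r0 rS] : nbhs v S by exact: open_nbhs_nbhs.
(* A point of the closed box is within [e k] of the rational centre in each coordinate, and so is v;
   half of r therefore keeps the box inside the ball around v. *)
have [k ke] : exists k, e k < r / 2.
  have r20 : 0 < r / 2 by rewrite divr_gt0.
  have [N _ /(_ N (leqnn N)) hN] := near_infty_natSinv_lt (PosNum r20).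
  by exists N.
have /choice[q hq] (j : 'I_n.+1) : exists q : rat, `|v 0 j - ratr q| < e k.
  have : ball (v 0 j) (e k) `&` range (@ratr R) !=set0.
    by apply: dense_rat; [exists (v 0 j); exact: ballxx|exact: ball_open].
  by move=> [_ [] /[swap] -[q _ <-] vq]; exists q.
apply: (hv (\row_j q j, k, i)) => /= [w hw|j]; last first.
  by rewrite !mxE; have := hq j; rewrite ltr_norml => /andP[? ?]; apply/andP; split; lra.
apply: rS; split => // j' j; rewrite ord1 /ball/= ltr_norml.
have := hw j; have := hq j; rewrite !mxE/= ltr_norml => /andP[? ?] /andP[? ?].
by apply/andP; split; lra.
Qed.

(** * Constants as test functions *)

Section bounded_sets.
Context {R : realType} {n : nat}.
Local Notation leb := (lebesgue_rV R n).

Lemma bounded_coord (K : set 'rV[R]_n) : bounded_set K ->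
  exists2 M : R, 0 < M & forall v, K v -> forall i, `|v 0 i| < M.
Proof.
move=> [M [Mr hM]]; exists (`|M| + 2); first by rewrite ltr_wpDl.
move=> v Kv i; have : `|v| <= `|M| + 1.
  by apply: hM => //; rewrite (le_lt_trans (ler_norm _))// ltrDl.
move=> h; apply: (@le_lt_trans _ _ (`|M| + 1)); last by rewrite ltrD2l ltr1n.
apply: le_trans h; rewrite [leRHS]/Num.norm /= mx_normrE.
exact: (le_bigmax _ (fun ij : 'I_1 * 'I_n => `|v ij.1 ij.2|) (0, i)).
Qed.

Lemma bounded_finite_measure (K : set 'rV[R]_n) : measurable K -> bounded_set K ->
  (leb K < +oo)%E.
Proof.
move=> mK /bounded_coord[M M0 KM].
apply: (@le_lt_trans _ _ (leb (obox (const_mx (- M)) (const_mx M)))).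
  apply: le_measure; rewrite ?inE//; first exact: measurable_obox.
  by move=> v /KM h j; rewrite !mxE -ltr_norml.
by rewrite lebesgue_rV_obox ltry.
Qed.

Lemma integrable_cst_bounded (K : set 'rV[R]_n) (c : R) : measurable K -> bounded_set K ->
  leb.-integrable K (EFin \o cst c).
Proof.
move=> mK bK; apply/integrableP; split; first exact/measurable_EFinP.
rewrite (eq_integral (cst `|c|%:E))// integral_cst//= lte_mul_pinfty//; exact: bounded_finite_measure.
Qed.

End bounded_sets.

Section constants.
Context {R : realType} {n : nat}.
Local Notation leb1 := (@lebesgue_measure R).
Local Notation lebn := (lebesgue_rV R n).
Local Notation leb := (lebesgue_rV R n.+1).

Lemma partial_support (eta : 'rV[R]_n.+1 -> R) (i : 'I_n.+1) v :
  ~ closure [set x | eta x != 0] v -> partial i eta v = 0.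
Proof.
move=> nv; have d0 : (delta_mx 0 i : 'rV[R]_n.+1) != 0.
  by apply/eqP => /matrixP/(_ 0 i); rewrite !mxE !eqxx => /eqP; rewrite oner_eq0.
rewrite /partial (@near_eq_derive _ _ _ eta (cst 0)) ?derive_cst//.
have : \near v, (~` closure [set x | eta x != 0]) v.
  by apply: open_nbhs_nbhs; split => //; apply: closed_openC; exact: closed_closure.
apply: filterS => x nx; apply/eqP; apply: contrapT => /negP h.
by apply: nx; exact: subset_closure.
Qed.

Lemma integrable_partial (S : set 'rV[R]_n.+1) (eta : 'rV[R]_n.+1 -> R) (i : 'I_n.+1) :
  test_function S eta -> leb.-integrable setT (EFin \o partial i eta).
Proof.
move=> [sm [cK KS]]; pose K := closure [set x | eta x != 0].
have mK : measurable K by apply: measurable_closed_rV; exact: closed_closure.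
have dc : continuous (partial i eta) by have [] := sm [:: i].
have p0 v : ~ K v -> partial i eta v = 0 by exact: partial_support.
have bK := compact_bounded cK.
have mp : measurable_fun setT (partial i eta) by exact: continuous_measurable_rV.
have [B hB] : exists B, forall v, K v -> `|partial i eta v| <= B.
  have : compact (partial i eta @` K).
    by apply: continuous_compact => //; apply: continuous_subspaceT.
  move=> /compact_bounded[B [Br hB]]; exists (`|B| + 1) => v Kv; apply: hB; last by exists v.
  by rewrite (le_lt_trans (ler_norm _))// ltrDl.
have -> : partial i eta = partial i eta \_ K.
  by apply/funext => v; rewrite patchE; case: (pselect (K v)) => Kv;
    [rewrite mem_set|rewrite memNset// p0].
rewrite -restrict_EFin; apply: (integrable_mkcond _ mK).1.
have i1 : leb.-integrable K (EFin \o cst 1) by exact: integrable_cst_bounded.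
have := integrable_mul_bounded mK i1 (measurable_funTS mp) hB.
by apply: eq_integrable => // v _ /=; rewrite mul1r.
Qed.

(** On each line parallel to axis i, the fundamental theorem of calculus on [[-M, M]] gives 0, since
    eta vanishes at both ends. This is exactly the weak identity for constants with gradient 0. *)
Lemma integral_partial_eq0 (S : set 'rV[R]_n.+1) (eta : 'rV[R]_n.+1 -> R) (i : 'I_n.+1) :
  test_function S eta -> \int[leb]_(v in S) partial i eta v = 0.
Proof.
move=> teta; have iK := integrable_partial i teta.
have [sm [cK KS]] := teta; pose K := closure [set x | eta x != 0].
have bK := compact_bounded cK.
have dc : continuous (partial i eta) by have [] := sm [:: i].
have ds v : derivable eta v (delta_mx 0 i) by have [_] := sm [::]; exact.
have p0 v : ~ K v -> partial i eta v = 0 by exact: partial_support.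
have eta0 v : ~ K v -> eta v = 0.
  by move=> nK; apply/eqP; apply: contrapT => /negP h; apply: nK; exact: subset_closure.
rewrite (@Rintegral_support _ _ _ _ S K)// -(@Rintegral_support _ _ _ _ setT K)//.
rewrite /Rintegral -(integral_ins i iK).
rewrite (_ : (\int[lebn]_x _)%E = 0%E)//; apply: integral0_eq => x _.
have [M M0 KM] := bounded_coord bK.
have NK t : M <= `|t| -> ~ K (ins i (t, x)).
  by move=> Mt /KM /(_ i); rewrite ins_id /= ltNge Mt.
pose h (t : R) : R := eta (ins i (t, x)).
have dh (t : R) : is_derive t 1 h (partial i eta (ins i (t, x))).
  by rewrite partial_ins; apply: is_derive_derive1; apply/derivable_ins.
have dcx : continuous (fun t : R => partial i eta (ins i (t, x))).
  have cins : continuous (fun t : R => ins i (t, x)).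
    move=> t; apply/cvg_ballP => e e0; near=> s; split => // j' j; rewrite ord1.
    rewrite !mxE; case: unliftP => [k _|_] /=; first exact: ballxx.
    by near: s; exists e.
  by move=> t; exact: continuous_comp (cins t) (dc _).
rewrite (_ : (\int[leb1]_t _)%E = (\int[leb1]_(t in `[(- M)%R, M]) (partial i eta (ins i (t, x)))%:E)%E).
  rewrite (@continuous_FTC2 _ _ h)//.
  - by rewrite /h !eta0 ?subee//; apply: NK; rewrite ?normrN gtr0_norm.
  - by rewrite gtrN.
  - exact: continuous_subspaceT.
  - have ch : continuous h by apply: derivable_continuous1 => t; have [] := dh t.
    split; first by move=> t _; have [] := dh t.
      by apply: cvg_at_right_filter; exact: ch.
    by apply: cvg_at_left_filter; exact: ch.
  - by move=> t _; rewrite (derive1_eq (dh t)).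
rewrite [RHS]integral_mkcond; apply: eq_integral => t _; rewrite patchE.
case: (pselect (`[- M, M]%classic t)) => tM; first by rewrite mem_set.
rewrite memNset//= p0//; apply: NK; move/negP: tM; rewrite /= in_itv/= -ler_norml -ltNge.
exact: ltW.
Unshelve. all: by end_near. Qed.

Lemma weak_gradient_cst (S : set 'rV[R]_n.+1) (c : R) : measurable S ->
  weak_gradient S (cst c) (cst 0).
Proof.
move=> mS; have L1c (d : R) : L1_loc S (cst d).
  split; first exact: measurable_cst.
  move=> K cK KS; apply: integrable_cst_bounded; last exact: compact_bounded.
  apply: measurable_closed_rV; apply: compact_closed => //; exact: norm_hausdorff.
split => [//|i|eta teta i].
  by rewrite (_ : (fun x => _) = cst 0)//; apply/funext => x; rewrite mxE.
rewrite [X in _ = - X](_ : _ = 0); last first.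
  under eq_Rintegral do rewrite mxE mul0r.
  by rewrite /Rintegral integral0.
rewrite oppr0 RintegralZl//; last exact: integrableS (integrable_partial i teta).
by rewrite integral_partial_eq0// mulr0.
Qed.

End constants.

(** * The entropy inequality *)

Section truncation.
Context {R : realType}.
Implicit Types k s t : R.

Lemma truncE k s : 0 < k -> trunc k s = Num.max (- k) (Num.min k s).
Proof.
move=> k0; rewrite /trunc ltr_norml.
have [ks|ks] := leP k s.
  by rewrite andbF gtr0_sg ?mulr1 ?max_r//; [lra|exact: lt_le_trans ks].
by rewrite andbT; have [sk|//] := leP s (- k); rewrite ltr0_sg ?mulrN1//; lra.
Qed.

Lemma trunc_le k s t : 0 < k -> s <= t -> trunc k s <= trunc k t.
Proof.
move=> k0 st; rewrite !truncE// ge_max !le_max !le_min !ge_min !lexx st.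
by rewrite !orbT.
Qed.

(** Supplies the sign hypothesis of [gradient_sign] for two truncations of the same function. *)
Lemma trunc_monotone k l s t c d : 0 < k -> 0 < l ->
  0 <= (trunc k (s - c) - trunc k (t - c)) * (trunc l (s - d) - trunc l (t - d)).
Proof.
move=> k0 l0; case: (leP s t) => st.
  by apply: mulr_le0; rewrite subr_le0; apply: trunc_le => //; rewrite lerD2r.
by apply: mulr_ge0; rewrite subr_ge0; apply: trunc_le => //; rewrite lerD2r ltW.
Qed.

Lemma norm_trunc_le k s : 0 < k -> `|trunc k s| <= k.
Proof.
move=> k0; rewrite truncE// ler_norml le_max lexx/= ge_max ge_min lexx/= andbT.
lra.
Qed.

Lemma measurable_fun_trunc d (T : measurableType d) (D : set T) (f : T -> R) k : 0 < k ->
  measurable_fun D f -> measurable_fun D (trunc k \o f).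
Proof.
move=> k0 mf; rewrite (_ : _ \o _ = (fun x => Num.max (- k) (Num.min k (f x)))).
  by apply: measurable_maxr => //; exact: measurable_minr.
by apply/funext => x; rewrite /= truncE.
Qed.

Lemma cvg_trunc1_addn s : trunc 1 (s + m%:R) @[m --> \oo] --> (1 : R).
Proof.
apply: (@cvg_trans _ (cst 1 @ \oo)); last exact: cvg_cst.
apply: near_eq_cvg; near=> m.
have h : `|s| + 1 <= m%:R by near: m; exact: nbhs_infty_ger.
rewrite truncE// min_l; first by rewrite max_r //; lra.
by have := ler_norm (- s); rewrite normrN; lra.
Unshelve. all: by end_near. Qed.

Lemma cvg_trunc1_subn s : trunc 1 (s - m%:R) @[m --> \oo] --> (-1 : R).
Proof.
apply: (@cvg_trans _ (cst (-1) @ \oo)); last exact: cvg_cst.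
apply: near_eq_cvg; near=> m.
have h : `|s| + 1 <= m%:R by near: m; exact: nbhs_infty_ger.
rewrite truncE// max_l//; rewrite ge_min; apply/orP; right.
by have := ler_norm s; lra.
Unshelve. all: by end_near. Qed.

End truncation.

(** When the integral is infinite, its real value is the default [fine +oo = 0], so the conclusion
    stays true for the flux term without a finiteness argument. *)
Lemma Rintegral_ge0_ae d (T : measurableType d) (R : realType) (mu : {measure set T -> \bar R})
    (D : set T) (f : T -> R) : measurable D -> measurable_fun D f ->
  {ae mu, forall x, D x -> 0 <= f x} -> 0 <= \int[mu]_(x in D) f x.
Proof.
move=> mD mf f0; rewrite /Rintegral.
rewrite (@ae_eq_integral _ _ _ mu D (fun x => (Num.max (f x) 0)%:E))//.
- by apply: fine_ge0; apply: integral_ge0 => x _; rewrite lee_fin le_max lexx orbT.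
- exact/measurable_EFinP.
- by apply/measurable_EFinP; exact: measurable_maxr.
- by move: f0; apply: filterS => x h Dx; rewrite max_l// h.
Qed.

Section entropy.
Context {R : realType} {n : nat}.
Local Notation leb := (lebesgue_rV R n.+1).
Variables (S : set 'rV[R]_n.+1) (p : R) (gamma : 'rV[R]_n.+1 -> R).
Hypotheses (oS : open S) (bS : bounded_set S) (p1 : 1 < p).
Hypotheses (gamma0 : forall x, S x -> 0 < gamma x) (mgamma : measurable_fun S gamma).

Let mS : measurable S := measurable_open_rV oS.

Lemma weighted_sobolev_cst (c : R) : weighted_sobolev gamma p S (cst c).
Proof.
split.
  split; first exact: measurable_cst.
  have /integrableP[_] := integrable_cst_bounded (`|c| `^ p) mS bS.
  by under eq_integral do rewrite /= ger0_norm ?powR_ge0//.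
exists (cst 0); first exact: weak_gradient_cst.
rewrite (eq_integral (cst 0%E)) ?integral0// => x _.
rewrite /enorm /dot big1; last by move=> j _; rewrite mxE mul0r.
by rewrite sqrtr0 powR0 ?mulr0// gt_eqF// (lt_trans _ p1).
Qed.

Lemma measurable_coordS (F : 'rV[R]_n.+1 -> 'rV[R]_n.+1) i : measurable_fun S F ->
  measurable_fun S (fun x => F x 0 i).
Proof. by move=> mF; exact: (measurableT_comp (measurable_coord i) mF). Qed.

Lemma measurable_dot (F G : 'rV[R]_n.+1 -> 'rV[R]_n.+1) :
  (forall i, measurable_fun S (fun x => F x 0 i)) ->
  (forall i, measurable_fun S (fun x => G x 0 i)) ->
  measurable_fun S (fun x => dot (F x) (G x)).
Proof.
by move=> mF mG; apply: measurable_sum => i; exact: measurable_funM.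
Qed.

Lemma dot_p_flux (F G : 'rV[R]_n.+1) : dot (p_flux p F) G = enorm F `^ (p - 2) * dot F G.
Proof. by rewrite /dot mulr_sumr; apply: eq_bigr => i _; rewrite mxE mulrA. Qed.

(** Where [|f x|] is below m + 1, [F] is the weak gradient of the truncation at m + 1, so
    [gradient_sign] compares it with [G] componentwise. The flux is a nonnegative multiple of
    [F]. *)
Lemma entropy_trunc_ge0 f fhat (c : R) : entropy_operator gamma p S f fhat ->
  0 <= \int[leb]_(x in S) (fhat x * trunc 1 (f x - c)).
Proof.
move=> [L1f L1fhat _ [F [mF gF] ent]].
have [G wG] := ent 1 (cst c) ltr01 (weighted_sobolev_cst c)
  (conj (@measurable_cst _ _ _ _ _ _) (ex_intro _ `|c| (aeW _ (fun x _ => lexx _)))).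
apply: le_trans; apply: Rintegral_ge0_ae => //.
  under eq_fun do rewrite dot_p_flux.
  apply: measurable_funM => //; apply: measurable_funM.
    apply: (measurableT_comp (measurable_powR _)).
    have mdot : measurable_fun S (fun x => dot (F x) (F x)).
      by apply: measurable_dot => i; exact: measurable_coordS.
    have msqrt : measurable_fun setT (@Num.sqrt R).
      by apply: continuous_measurable_fun; exact: sqrt_continuous.
    exact: (measurableT_comp msqrt mdot).
  by apply: measurable_dot => i; [exact: measurable_coordS|case: wG => _ /(_ i)[]].
(* Integer levels suffice, as every real value of f lies below one of them, and they cost only
   countably many null sets. *)
have : {ae leb, forall x, forall m : nat, S x -> `|f x| < m.+1%:R -> forall i, 0 <= G x 0 i * F x 0 i}.
  apply: ae_forall_countable => m.
  have [H wH aeH] := gF m.+1%:R (ltr0Sn _ _).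
  have mono v w : S v -> S w -> 0 <= (trunc 1 (f v - cst c v) - trunc 1 (f w - cst c w)) *
      ((trunc m.+1%:R \o f) v - (trunc m.+1%:R \o f) w).
    move=> _ _; have := @trunc_monotone R 1 m.+1%:R (f v) (f w) c 0 ltr01 (ltr0Sn _ _).
    by rewrite !subr0.
  have := gradient_sign oS wG wH mono; move: aeH; apply: filterS2 => x h1 h2 Sx fm i.
  by have := h2 Sx i; rewrite (h1 Sx) fm.
apply: filterS => x h Sx; apply: mulr_ge0; first exact/ltW/gamma0.
rewrite dot_p_flux mulr_ge0 ?powR_ge0//; apply: sumr_ge0 => i _; rewrite mulrC.
apply: (h (Num.bound `|f x|)) => //.
apply: (@lt_le_trans _ _ (Num.bound `|f x|)%:R); last by rewrite ler_nat.
exact: archi_boundP.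
Qed.

Lemma integral_entropy_eq0 f fhat : entropy_operator gamma p S f fhat ->
  \int[leb]_(x in S) fhat x = 0.
Proof.
move=> ent; have [L1f L1fhat _ _] := ent.
have mf : measurable_fun S f by apply/measurable_EFinP; exact: measurable_int L1f.
have mfhat : measurable_fun S fhat by apply/measurable_EFinP; exact: measurable_int L1fhat.
(* Here [u m] is the constant c. Since [trunc 1] is bounded by 1, [|fhat|] dominates; the cases l =
   -1 and l = 1 give the two inequalities below. *)
have lim (u : nat -> R) (l : R) : (forall s, trunc 1 (s - u m) @[m --> \oo] --> l) ->
    0 <= l * \int[leb]_(x in S) fhat x.
  move=> hu; pose h m x := fhat x * trunc 1 (f x - u m).
  have mh m : measurable_fun S (EFin \o h m).
    apply/measurable_EFinP; apply: measurable_funM => //.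
    by apply: (measurable_fun_trunc (f := fun x => f x - u m)) => //; exact: measurable_funB.
  have hl x : S x -> (h m x)%:E @[m --> \oo] --> (fhat x * l)%:E.
    by move=> _; apply: cvg_EFin; [exact: nearW|apply: cvgMr; exact: hu].
  have gfin x : S x -> `|fhat x|%:E \is a fin_num by [].
  have hg m x : S x -> (`|(h m x)%:E| <= `|fhat x|%:E)%E.
    by move=> _; rewrite lee_fin normrM ler_piMr// norm_trunc_le.
  have cv := dominated_cvg mS mh hl gfin (integrable_abse L1fhat) hg.
  rewrite mulrC -RintegralZr// /Rintegral; apply: fine_ge0.
  apply: cvge_ge cv.
  apply: nearW => m; have := entropy_trunc_ge0 (u m) ent.
  rewrite /Rintegral -lee_fin fineK//; apply: integrable_fin_num => //.
  apply: (integrable_mul_bounded (C := 1)) => //.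
    by apply: (measurable_fun_trunc (f := fun x => f x - u m)) => //; exact: measurable_funB.
  by move=> x _; exact: norm_trunc_le.
apply/eqP; rewrite eq_le; apply/andP; split.
  by rewrite -oppr_ge0 -mulN1r; apply: (lim (fun m => m%:R)) => s; exact: cvg_trunc1_subn.
rewrite -[leRHS]mul1r; apply: (lim (fun m => - m%:R)) => s.
by under eq_cvg do rewrite opprK; exact: cvg_trunc1_addn.
Qed.

End entropy.

(** * Conservation of mass *)

Section mass_conservation.
Context {R : realType} {n : nat} (S : set 'rV[R]_n) (mS : measurable S).
Local Notation leb := (lebesgue_rV R n).
Variables (B : ('rV[R]_n -> R) -> ('rV[R]_n -> R) -> Prop).
Hypothesis B0 : forall f g, B f g -> \int[leb]_(x in S) g x = 0.
Variables (u : 'rV[R]_n -> R) (v : R -> 'rV[R]_n -> R).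
Hypotheses (L1u : L1 S u) (sol : strong_solution S B u v).

Let mass t := \int[leb]_(x in S) v t x.

Let L1v t : 0 <= t -> L1 S (v t). Proof. by case: sol => h _ _ _; exact: h. Qed.

Let integrable_diff s t : 0 <= s -> 0 <= t -> leb.-integrable S (EFin \o (v t \- v s)).
Proof. by move=> s0 t0; exact: (integrableB mS (L1v t0) (L1v s0)). Qed.

Let mass_le s t : 0 <= s -> 0 <= t -> `|mass t - mass s| <= L1_norm S (v t \- v s).
Proof.
move=> s0 t0; rewrite /mass -(RintegralB mS (L1v t0) (L1v s0)).
exact: (le_normr_Rintegral mS (integrable_diff s0 t0)).
Qed.

(** Subtracting d under the integral changes nothing because d has integral 0; the L^1 derivative of
    the curve then forces the derivative of the mass to be 0. *)
Let mass_quotient_le t d h : 0 <= t -> 0 <= t + h -> L1 S d -> \int[leb]_(x in S) d x = 0 ->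
  `|h^-1 * (mass (t + h) - mass t)| <= L1_norm S (fun x => h^-1 * (v (t + h) x - v t x) - d x).
Proof.
move=> t0 th0 L1d d0; have idiff := integrable_diff t0 th0.
have iZ : leb.-integrable S (fun x => (h^-1 * (v (t + h) x - v t x))%:E).
  exact: (integrableZl mS h^-1 idiff).
have -> : h^-1 * (mass (t + h) - mass t) =
    \int[leb]_(x in S) (h^-1 * (v (t + h) x - v t x) - d x).
  rewrite (RintegralB mS iZ L1d) d0 subr0 (RintegralZl _ mS idiff) /mass.
  by rewrite -(RintegralB mS (L1v th0) (L1v t0)).
exact: (le_normr_Rintegral mS (integrableB mS iZ L1d)).
Qed.

(** The start is positive because absolute continuity is available only on compact intervals inside
    []0, +oo[]. *)
Let mass_constant_pos a b : 0 < a -> a < b -> mass a = mass b.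
Proof.
move=> a0 ab; have [_ [_ ac] _ dv] := sol.
apply: absolutely_continuous_deriv0 => //.
  move=> e e0; have [d d0 acd] := ac a b a0 ab e e0; exists d => // N s t st tI sumd.
  apply: le_lt_trans (acd N s t st tI sumd); apply: ler_sum => i _.
  by have [as_ st_ _] := st i; apply: mass_le; lra.
move: dv; apply: filterS; first exact: (ae_filter_ringOfSetsType (@lebesgue_measure R)).
move=> t ht /andP[at_ tb]; have t0 : 0 < t by lra.
have [d [L1d cd] Bd] := ht t0.
have d0 : \int[leb]_(x in S) d x = 0.
  have := B0 Bd; rewrite (@eq_Rintegral _ _ _ _ _ (fun x => -1 * d x)); last first.
    by move=> x _; rewrite mulN1r.
  by rewrite RintegralZl// mulN1r => /eqP; rewrite oppr_eq0 => /eqP.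
apply/cvgr0Pnorm_le => e e0.
move/cvgr0Pnorm_le : cd => /(_ e e0); rewrite !near_withinE => h1.
(* Negative h are allowed as well, and this keeps [t + h] in the range where the curve is known to
   be in L^1. *)
have hle : \forall h \near (0 : R), `|h| <= t by exact: nbhs0_le.
apply: filterS2 hle h1 => h + h1 hn0; rewrite ler_norml => /andP[th _].
have th0 : 0 <= t + h by lra.
apply: (le_trans (mass_quotient_le (ltW t0) th0 L1d d0)).
exact: le_trans (ler_norm _) (h1 hn0).
Qed.

Lemma strong_solution_mean t : 0 <= t -> mean S (v t) = mean S u.
Proof.
have [_ [cont _] v0u _] := sol.
have -> : mean S u = mean S (v 0).
  rewrite /mean /Rintegral; congr (_ * fine _); apply: ae_eq_integral => //.
  - exact: measurable_int L1u.
  - exact: measurable_int (L1v (lexx 0)).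
  - by move: v0u; apply: filterS => x h Sx /=; rewrite h.
(* Time 0 is reached by continuity: for small positive s the mass at s is within e of the mass at 0,
   and it equals the mass at t. *)
rewrite le_eqVlt => /predU1P[<-//|t0]; rewrite /mean; congr (_ * _).
rewrite -/(mass t) -/(mass 0); apply/eqP; rewrite -subr_eq0 -normr_le0.
apply/ler_addgt0Pl => e e0; rewrite addr0.
have /cvgr0Pnorm_le/(_ e e0) := cont 0 (lexx 0); rewrite near_withinE => /nbhs_ballP[r /= r0 hr].
pose s := Num.min (r / 2) (t / 2).
have s0 : 0 < s by rewrite lt_min !divr_gt0.
have st : s < t by rewrite gt_min; apply/orP; right; lra.
have sr : s < r by rewrite gt_min; apply/orP; left; lra.
rewrite -(mass_constant_pos s0 st); apply: (le_trans (mass_le (lexx 0) (ltW s0))).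
apply: (le_trans (ler_norm _)); apply: hr => /=; last exact: ltW.
by rewrite /ball/= sub0r normrN gtr0_norm.
Qed.

End mass_conservation.

Theorem lemma3p4 (R : realType) (n : nat) (S : set 'rV[R]_n) (p : R)
  (gamma : 'rV[R]_n -> R) (T : R -> ('rV[R]_n -> R) -> ('rV[R]_n -> R)) :
  (2 <= n)%N ->
  S !=set0 -> open S -> connected S -> bounded_set S -> C1_boundary S ->
  1 < p -> p != 2 ->
  (forall x, S x -> 0 < gamma x) ->
  Linfty S gamma ->
  L1 S (fun x => gamma x `^ (1 - p)^-1) ->
  (exists2 gamma0 : 'rV[R]_n -> R, muckenhoupt p gamma0 &
    {ae lebesgue_rV R n, forall x, S x -> gamma0 x = gamma x}) ->
  is_semigroup_of S (entropy_operator gamma p S) T ->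
  forall u : 'rV[R]_n -> R, L1 S u ->
  forall t : R, 0 <= t -> mean S (T t u) = mean S u.
Proof.
(* The dimension is written as a successor, the form in which a coordinate can be split off. *)
case: n S gamma T => [|n] S gamma T // _ _ oS _ bS _ p1 _ gamma0 [mgamma _] _ _ sg u L1u.
apply: (strong_solution_mean (measurable_open_rV oS) _ L1u (sg u L1u)) => f g.
exact: integral_entropy_eq0.
Qed.
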